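(* Let $R$ be a non-constant rational function, $C$ the set of critical points of $R$, and $Y = C(\operatorname{graph} R)$ the Hilbert bimodule over $B = C(\hat{\mathbb{C}})$. Similarly, when $J_R \neq \emptyset$, let $A = C(J_R)$ and $X = C(\operatorname{graph} R|_{J_R})$. Consider the ideal $I_Y = \phi^{-1}(K(Y))$ of $B$ and the ideal $I_X = \phi^{-1}(K(X))$ of $A$. Then $$I_Y = \{b \in B : b \text{ vanishes on } C\} \quad\text{and}\quad I_X = \{a \in A : a \text{ vanishes on } C \cap J_R\}.$$
   Context: A rational function $R = P/Q$ ($P,Q$ relatively prime complex polynomials) is regarded as a map of the Riemann sphere $\hat{\mathbb{C}}$ to itself. The Julia set $J_R$ is the complement of the maximal open subset of $\hat{\mathbb{C}}$ on which the iterates $(R^n)_n$ are equicontinuous; it satisfies $R(J_R) = J_R = R^{-1}(J_R)$. The branch index $e(x)$ at $x \in \hat{\mathbb{C}}$ is the integer $n\ge 1$ such that, in appropriate local charts, $R(z) = R(x) + c(z-x)^n + (\text{higher terms})$ with $c \neq 0$; $x$ is a critical point iff $e(x) \ge 2$. $\operatorname{graph} R = \{(x,y) \in \hat{\mathbb{C}}^2 : y = R(x)\}$, $\operatorname{graph} R|_{J_R} = \{(x,y) \in J_R \times J_R : y = R(x)\}$. $Y$ is a Hilbert $B$-bimodule with $(a\cdot f\cdot b)(x,y) = a(x)f(x,y)b(y)$ and right inner product $(f|g)_B(y) = \sum_{x \in R^{-1}(y)} e(x)\overline{f(x,y)}g(x,y)$; $X$ is a Hilbert $A$-bimodule with the same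 formulas restricted to $J_R$. In each case $\phi$ denotes the left action, $(\phi(b)f)(x,y) = b(x)f(x,y)$, as a homomorphism into the adjointable operators, and $K(\cdot)$ is the closed linear span of the rank one operators $\theta_{\xi,\eta}(\zeta) = \xi(\eta|\zeta)$. *)

(* Defs.v *)
From mathcomp Require Import all_boot all_order all_algebra.
From mathcomp Require Import complex.
From mathcomp Require Import all_classical all_reals all_analysis.

Set Implicit Arguments.
Unset Strict Implicit.
Unset Printing Implicit Defensive.

Import Order.TTheory GRing.Theory Num.Theory.
Import numFieldNormedType.Exports.

Local Open Scope classical_set_scope.
Local Open Scope ring_scope.

(* R[i] packed as a structure, so that it inherits the norm topology that
   numFieldNormedType puts on the sort of any numFieldType. *)
Definition Cplx (R : realType) : numClosedFieldType := R[i].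
Arguments Cplx R : simpl never.

Definition cabs (R : realType) (z : Cplx R) : R := complex.Re (`|z| : R[i]).

(* None is the point at infinity. *)
Notation sphere R := (one_point_compactification (Cplx R)).

Section RationalMaps.
Variable R : realType.
Local Notation C := (Cplx R).
Local Notation S := (sphere R).

Record ratfun := RatFun {
  rnum : {poly C};
  rden : {poly C};
  rden_neq0 : rden != 0;
  rcoprime : coprimep rnum rden }.

(* At infinity the value is the limit of P / Q: it is infinite if
   deg P > deg Q, and otherwise the quotient of the coefficients of degree
   deg Q (this is 0 if deg P < deg Q). *)
Definition ratmap (f : ratfun) (z : S) : S :=
  let P := rnum f in let Q := rden f in
  if z is Some a then
    if Q.[a] == 0 then None else Some (P.[a] / Q.[a])
  else
    if (size Q < size P)%N then None
    else Some (P`_(size Q).-1 / lead_coef Q).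

Coercion ratmap : ratfun >-> Funclass.

Definition nonconstant (f : ratfun) := ~ exists w : S, forall z : S, f z = w.

(* Chordal distance; it induces the unique uniformity of the compact space S. *)
Definition chordal (z w : S) : R :=
  match z, w with
  | Some a, Some b =>
      2 * cabs (a - b) /
        (Num.sqrt (1 + cabs a ^+ 2) * Num.sqrt (1 + cabs b ^+ 2))
  | Some a, None | None, Some a => 2 / Num.sqrt (1 + cabs a ^+ 2)
  | None, None => 0
  end.

Definition iterates_equicontinuous_on (f : S -> S) (U : set S) :=
  forall x, U x -> forall eps : R, 0 < eps ->
    \forall y \near x, forall n : nat, chordal (iter n f x) (iter n f y) < eps.

(* Equicontinuity on an open set being a pointwise condition, the union of all
   the open sets on which the iterates are equicontinuous is the largest one. *)
Definition fatou (f : S -> S) : set S :=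
  \bigcup_(U in [set U | open U /\ iterates_equicontinuous_on f U]) U.

Definition julia (f : S -> S) : set S := ~` fatou f.

(* The chart z at a finite point p, the chart 1/z at infinity.  The values at
   points outside the domain of the chart (infinity, resp. 0) are irrelevant. *)
Definition chart (p z : S) : C :=
  if z is Some a then (if p is Some _ then a else a^-1) else 0.

Definition chart_inv (p : S) (u : C) : S :=
  if p is Some _ then Some u else if u == 0 then None else Some u^-1.

Definition local_rep (f : S -> S) (x : S) (u : C) : C :=
  chart (f x) (f (chart_inv x u)).

Definition is_branch_index (f : S -> S) (x : S) (n : nat) :=
  let u0 := chart x x in
  let h := local_rep f x in
  let F := nbhs u0 in
  (1 <= n)%N /\
  exists c : C, c != 0 /\
    h = (fun u : C => h u0 + c * (u - u0) ^+ n)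
        +O_F (fun u : C => (u - u0) ^+ n.+1).

Definition branch_index (f : S -> S) (x : S) : nat :=
  xget 0%N [set n | is_branch_index f x n].

Definition critical (f : S -> S) : set S :=
  [set x | (2 <= branch_index f x)%N].

End RationalMaps.

(* The Hilbert bimodule C(G) over C(T), for a relation G on T (the graph of a
   map) weighted by e.  Functions on G are arbitrary, and the elements of C(G)
   are singled out by continuity (for the subspace topology on G); accordingly,
   operators are maps on all functions, of which only the values on C(G)
   matter. *)
Section Bimodule.
Variables (R : realType) (T : topologicalType) (G : set (T * T)) (e : T -> nat).
Local Notation C := (Cplx R).
Local Notation fct := (G -> C).

Definition lact (a : T -> C) (f : fct) : fct :=
  fun p => a (set_val p).1 * f p.

Definition ract (f : fct) (b : T -> C) : fct :=
  fun p => f p * b (set_val p).2.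

Definition rinner (f g : fct) (y : T) : C :=
  \sum_(p \in [set p : G | (set_val p).2 = y])
    (e (set_val p).1)%:R * (f p)^* * g p.

Definition supnorm (b : T -> C) : R := sup [set cabs (b y) | y in setT].

Definition hnorm (f : fct) : R := Num.sqrt (supnorm (rinner f f)).

Definition preserves_continuity (A : fct -> fct) :=
  forall f : fct, continuous f -> continuous (A f).

Definition adjointable (A : fct -> fct) :=
  preserves_continuity A /\
  exists A' : fct -> fct, preserves_continuity A' /\
    forall f g : fct, continuous f -> continuous g ->
      rinner (A f) g = rinner f (A' g).

Definition opnorm (A : fct -> fct) : \bar R :=
  ereal_sup [set (hnorm (A f))%:E |
    f in [set f : fct | continuous f /\ hnorm f <= 1]].

Definition rank_one (xi eta zeta : fct) : fct := ract xi (rinner eta zeta).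

Definition rank_one_span : set (fct -> fct) :=
  [set A | exists (n : nat) (c : 'I_n -> C) (xi eta : 'I_n -> fct),
    (forall i, continuous (xi i) /\ continuous (eta i)) /\
    A = (fun zeta p => \sum_(i < n) c i * rank_one (xi i) (eta i) zeta p)].

Definition compact_operators : set (fct -> fct) :=
  [set A | adjointable A /\
    forall eps : R, 0 < eps -> exists2 A0, rank_one_span A0 &
      (opnorm (fun f p => A f p - A0 f p)%R < eps%:E)%E].

Definition compact_ideal : set (T -> C) :=
  [set a | continuous a /\ compact_operators (lact a)].

End Bimodule.

Section Graphs.
Variables (R : realType) (f : sphere R -> sphere R).

Definition graph : set (sphere R * sphere R) := [set p | p.2 = f p.1].

Definition ideal_sphere : set (sphere R -> Cplx R) :=
  compact_ideal graph (branch_index f).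

Definition julia_graph : set (julia f * julia f) :=
  [set p | set_val p.2 = f (set_val p.1)].

Definition ideal_julia : set (julia f -> Cplx R) :=
  compact_ideal julia_graph (branch_index f \o set_val).

End Graphs.

Arguments ideal_sphere {R} f.
Arguments julia_graph {R} f.
Arguments ideal_julia {R} f.

(* Main.v *)
Require Import Defs.
From mathcomp Require Import all_boot all_order all_algebra.
From mathcomp Require Import complex.
From mathcomp Require Import all_classical all_reals all_analysis.
From mathcomp Require Import ring lra.
Set Implicit Arguments.
Unset Strict Implicit.
Unset Printing Implicit Defensive.
Import Order.TTheory GRing.Theory Num.Theory.
Import numFieldNormedType.Exports.
Local Open Scope classical_set_scope.
Local Open Scope ring_scope.

(** Fix [a] in the algebra.  Off the critical points the map is locally
    injective, so a bump function [g] supported near a noncritical point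
    satisfies [phi (a g^2) = theta_(a g, g)]; if [a] vanishes on the critical
    points, [a] is uniformly approximated by [a * s / (s + delta)] with [s] a
    finite sum of such squares [g^2].  Conversely, let
    [phi a] be within [eps] of [sum_i c_i theta_(xi_i, eta_i)], and put
    [s = sum_i c_i xi_i (eta_i)^*].  Testing on functions concentrated at a
    single point of a fibre gives [|a x - e x * s x| <= K * eps] for every [x].
    If [x] is critical, then [e = 1] at the points near [x] other than [x], so
    by continuity also [|a x - s x| <= K * eps], and comparing the two forces
    [a x = 0], provided [x] is not isolated in the space.

    For the Julia set this last point needs an argument.  Suppose that the
    critical point [x] is isolated in [J].  It is not periodic (it would be
    superattracting), so its backward orbit contains two finite points [p] and
    [q] that no iterate takes on a small disc around [x].  The iterates are
    equicontinuous on a circle around [x]; by Hurwitz' theorem, if an iterate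
    comes very close to [p] at one point of the circle, it is close to [p], hence
    far from [q], on the whole circle.  So each iterate stays uniformly away
    from [p] or from [q] on the circle, and, by the maximum principle applied to
    [1 / (f^n - p)] or [1 / (f^n - q)], on the disc.  By the Schwarz lemma the
    iterates are then equicontinuous at [x], a contradiction. *)

(** * Modulus of complex numbers *)

(** All the analysis is done with quotients of polynomials. In homogeneous coordinates every iterate
    is such a quotient in a chart, with no exception at infinity. Openness comes from comparing the
    linear factors of a polynomial at two points, the maximum principle from openness, and the
    Schwarz lemma from dividing out [u - c]. The iterates have unbounded degree, so the estimates
    applied to them carry constants that do not depend on the degree. Two omitted values suffice,
    where Montel's theorem asks for three, because equicontinuity is already known away from the
    centre of the disc. Both ideals are computed in one abstract bimodule, over a compact space with
    a finite-to-one map. Rational maps enter it only through the size of the fibres, the bounds on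
    the branch index, the discreteness of the critical points, local injectivity elsewhere, and the
    fact that critical points are not isolated. *)

Section Cabs.
Variable R : realType.
Local Notation C := (Cplx R).
Local Notation S := (sphere R).
Implicit Types (x y z u v : C).

Lemma cabsE z : (cabs z)%:C%C = `|z| :> C.
Proof. by case: z => a b; rewrite /cabs /=. Qed.

Lemma lecabs z w : (`|z| <= `|w|) = (cabs z <= cabs w).
Proof. by rewrite -!cabsE lecR. Qed.

Lemma cabs_ge0 z : 0 <= cabs z.
Proof. by rewrite -lecR cabsE normr_ge0. Qed.

Lemma cabs0 : cabs (0 : C) = 0.
Proof. by rewrite /cabs normr0. Qed.

Lemma cabs_eq0 z : (cabs z == 0) = (z == 0).
Proof.
apply/eqP/eqP => [h|->]; last exact: cabs0.
by apply/normr0_eq0; rewrite -cabsE h.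
Qed.

Lemma cabs_gt0 z : (0 < cabs z) = (z != 0).
Proof. by rewrite lt_def cabs_ge0 andbT cabs_eq0. Qed.

Lemma cabsM z w : cabs (z * w) = cabs z * cabs w.
Proof.
apply: (@complexI R); rewrite cabsE normrM rmorphM /=.
by rewrite -!cabsE.
Qed.

Lemma cabs1 : cabs (1 : C) = 1.
Proof. by rewrite /cabs normr1. Qed.

Lemma cabsN z : cabs (- z) = cabs z.
Proof. by rewrite /cabs normrN. Qed.

Lemma cabsV z : cabs z^-1 = (cabs z)^-1.
Proof.
have [->|z0] := eqVneq z 0; first by rewrite invr0 cabs0 invr0.
apply: (mulfI (x := cabs z)); first by rewrite cabs_eq0.
by rewrite -cabsM !divff ?cabs_eq0 // cabs1.
Qed.

Lemma cabs_div z w : cabs (z / w) = cabs z / cabs w.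
Proof. by rewrite cabsM cabsV. Qed.

Lemma cabsX z n : cabs (z ^+ n) = cabs z ^+ n.
Proof. by elim: n => [|n IH]; rewrite ?expr0 ?cabs1 // !exprS cabsM IH. Qed.

Lemma cabs_triangle z w : cabs (z + w) <= cabs z + cabs w.
Proof. by rewrite -lecR rmorphD /= !cabsE; exact: ler_normD. Qed.

Lemma cabs_triangleB z w : cabs (z - w) <= cabs z + cabs w.
Proof. by rewrite -[X in _ <= _ + X]cabsN; exact: cabs_triangle. Qed.

Lemma cabs_distC z w : cabs (z - w) = cabs (w - z).
Proof. by rewrite -cabsN opprB. Qed.

Lemma cabs_lower z w : cabs z - cabs w <= cabs (z - w).
Proof. by rewrite lerBlDr -{1}(subrK w z); exact: cabs_triangle. Qed.

Lemma cabs_conj z : cabs (z^* ) = cabs z.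
Proof. by rewrite /cabs norm_conjC. Qed.

Lemma cabs_nat n : cabs (n%:R : C) = n%:R.
Proof. by apply: (@complexI R); rewrite cabsE normr_nat rmorph_nat. Qed.

Lemma cabs_sum (I : Type) (r : seq I) (P : pred I) (F : I -> C) :
  cabs (\sum_(i <- r | P i) F i) <= \sum_(i <- r | P i) cabs (F i).
Proof.
elim/big_ind2: _ => [|x x' y y' hx hy|//]; first by rewrite cabs0.
by apply: le_trans (cabs_triangle _ _) _; apply: lerD.
Qed.

Lemma cabs_prod (I : Type) (r : seq I) (P : pred I) (F : I -> C) :
  cabs (\prod_(i <- r | P i) F i) = \prod_(i <- r | P i) cabs (F i).
Proof. by elim/big_rec2: _ => [|i x y _ <-]; rewrite ?cabs1 ?cabsM. Qed.

Definition rc (r : R) : C := (r%:C)%C.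

Lemma cabs_rc r : cabs (rc r) = `|r|.
Proof. by rewrite /cabs /rc normc_def /= expr0n /= addr0 sqrtr_sqr. Qed.

Lemma cabs_rc_ge0 r : 0 <= r -> cabs (rc r) = r.
Proof. by move=> r0; rewrite cabs_rc ger0_norm. Qed.

Lemma mulr_conj z : z^* * z = rc (cabs z ^+ 2).
Proof. by rewrite mulrC -normCK -cabsE /rc rmorphXn. Qed.

Lemma rcD r s : rc (r + s) = rc r + rc s. Proof. exact: rmorphD. Qed.
Lemma rcM r s : rc (r * s) = rc r * rc s. Proof. exact: rmorphM. Qed.
Lemma rc_nat n : rc n%:R = n%:R. Proof. exact: rmorph_nat. Qed.

(** The radii of [ball] in [Cplx R] are positive elements of the field itself; they are traded here
    for positive reals. *)
Lemma nbhs_cabsP (u : C) (A : set C) :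
  nbhs u A <-> exists2 e : R, 0 < e & forall v, cabs (v - u) < e -> A v.
Proof.
split=> [/nbhs_ballP[e /= e0 he]|[e e0 he]].
  exists (cabs (e : C)); first by rewrite cabs_gt0 gt_eqF.
  move=> v hv; apply: he; rewrite /ball /= distrC.
  by rewrite -[e]gtr0_norm // -!cabsE ltcR.
apply/nbhs_ballP; exists (rc e); first by rewrite /= /rc ltcR.
move=> v; rewrite /ball /= distrC => hv; apply: he.
by rewrite -ltcR cabsE.
Qed.

Lemma near_cabs (u : C) (e : R) : 0 < e -> \forall v \near u, cabs (v - u) < e.
Proof. by move=> e0; apply/nbhs_cabsP; exists e. Qed.

Lemma continuous_cabsP (T : topologicalType) (f : T -> C) (x : T) :
  {for x, continuous f} <->
  forall e : R, 0 < e -> \forall y \near x, cabs (f y - f x) < e.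
Proof.
split=> [hf e e0|hf A /nbhs_cabsP[e e0 he]].
  by apply: (hf [set v | cabs (v - f x) < e]); exact: near_cabs.
by apply: filterS (hf _ e0) => y; exact: he.
Qed.

Lemma continuous_cabs : continuous (@cabs R).
Proof.
move=> u A /nbhs_ballP[e /= e0 he]; apply: filterS (near_cabs u e0) => v.
move=> hv; apply: he; apply: le_lt_trans hv; rewrite /= ler_norml.
have := cabs_lower v u; have := cabs_lower u v; rewrite (cabs_distC u v); lra.
Qed.

Lemma continuous_rc : continuous rc.
Proof.
move=> r; apply/continuous_cabsP => e e0; near=> s.
rewrite -(rmorphB (real_complex R)) -/(rc _) cabs_rc.
by near: s; apply: cvgr_distC_lt; [exact: cvg_id|].
Unshelve. all: by end_near. Qed.

Lemma continuous_conj : continuous (fun z : C => z^* ).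
Proof.
move=> u; apply/continuous_cabsP => e e0; apply: filterS (near_cabs u e0) => v.
by rewrite -rmorphB cabs_conj.
Qed.

Lemma continuous_dist (c : C) : continuous (fun u : C => cabs (u - c)).
Proof.
move=> u; apply: (@continuous_comp _ _ _ (fun u : C => u - c) (@cabs R)).
  apply/continuous_cabsP => e e0; apply: filterS (near_cabs u e0) => v.
  by rewrite opprB addrA subrK.
exact: continuous_cabs.
Qed.

Lemma cabs_rect (x y : R) :
  cabs (rc x + 'i%C * rc y : C) = Num.sqrt (x ^+ 2 + y ^+ 2).
Proof. by rewrite /cabs normc_def /= !(mul0r, mul1r, subr0, add0r, addr0). Qed.

Lemma compact_disc (c : C) (r : R) : compact [set u : C | cabs (u - c) <= r].
Proof.
(* The disc is a closed subset of the continuous image of a square. *)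
pose g (p : R * R) : C := rc p.1 + 'i%C * rc p.2 + c.
have cg : continuous g.
  move=> p; apply: cvgD; last exact: cvg_cst.
  apply: cvgD; first by apply: continuous_comp; [exact: cvg_fst|exact: continuous_rc].
  apply: cvgM; first exact: cvg_cst.
  by apply: continuous_comp; [exact: cvg_snd|exact: continuous_rc].
have K : compact (g @` (`[-r, r] `*` `[-r, r])).
  apply: continuous_compact; first exact: continuous_subspaceT.
  by apply: compact_setX; exact: segment_compact.
apply: (subclosed_compact _ K).
  rewrite (_ : [set _ | _] = (fun u : C => cabs (u - c)) @^-1` [set x | x <= r]) //.
  apply: closed_comp; last exact: closed_le.
  by move=> u _; exact: continuous_dist.
move=> u /= hu; exists (complex.Re ((u - c) : R[i]), complex.Im ((u - c) : R[i])).
  have hc : cabs (u - c) = Num.sqrt (complex.Re ((u - c) : R[i]) ^+ 2 + complex.Im ((u - c) : R[i]) ^+ 2).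
    by rewrite /cabs normc_def.
  split; rewrite /= in_itv /= -ler_norml; apply: le_trans hu; rewrite hc -sqrtr_sqr ler_wsqrtr //.
    by rewrite lerDl sqr_ge0.
  by rewrite lerDr sqr_ge0.
rewrite /g /= -[RHS](subrK c); congr (_ + c).
exact: esym (complexE (u - c)).
Qed.

End Cabs.

(** * The chordal metric *)

Lemma compact_locally_bounded (R : realType) (T : topologicalType) (K : set T) (g : T -> R) :
  compact K -> (forall x, K x -> exists M, \forall y \near x, g y <= M) ->
  exists M, forall x, K x -> g x <= M.
Proof.
move=> /compact_near_coveringP cK hK.
have [] := cK R (@pinfty_nbhs R) (fun M x => g x <= M) _.
  move=> x /hK[M hM].
  exists ([set y | g y <= M], [set M' | M < M']) => /=.
    by split=> //; exists M; split => //; exact: num_real.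
  by move=> [y M'] /= [h1 /ltW]; exact: le_trans.
by move=> M [_ hM]; exists (M + 1) => x Kx; apply: hM => //; rewrite ltrDl.
Qed.

Lemma compact_uniform_pos (R : realType) (T : topologicalType) (K : set T)
  (P : R -> T -> Prop) : compact K -> (forall s t x, s <= t -> P t x -> P s x) ->
  (forall x, K x -> exists2 t, 0 < t & \forall y \near x, P t y) ->
  exists2 t, 0 < t & forall x, K x -> P t x.
Proof.
move=> /compact_near_coveringP cK Pmono hK.
(* Writing [t = M^-1] turns arbitrarily small [t] into the filter at infinity. *)
have [] := cK R (@pinfty_nbhs R) (fun M x => P M^-1 x) _.
  move=> x /hK[t t0 ht].
  exists ([set y | P t y], [set M | t^-1 < M]) => /=.
    by split=> //; exists t^-1; split => //; exact: num_real.
  move=> [y M] /= [h1 h2]; apply: Pmono h1.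
  have M0 : 0 < M by apply: lt_trans h2; rewrite invr_gt0.
  by rewrite -[leRHS]invrK lef_pV2 ?posrE ?invr_gt0 // ltW.
move=> M [_ hM]; exists (`|M| + 1)^-1 => [|x Kx]; first by rewrite invr_gt0 ltr_wpDl.
by apply: (hM (`|M| + 1)) => //; have := ler_norm M; lra.
Qed.

Section Chordal.
Variable R : realType.
Local Notation C := (Cplx R).
Local Notation S := (sphere R).
Implicit Types (p q r s a b : C) (x y z : S).

Definition hnrm p q : R := Num.sqrt (cabs p ^+ 2 + cabs q ^+ 2).
(* The point with homogeneous coordinates [[p : q]]. *)
Definition pt p q : S := if q == 0 then None else Some (p / q).

Lemma hnrm_sqr p q : hnrm p q ^+ 2 = cabs p ^+ 2 + cabs q ^+ 2.
Proof. by rewrite sqr_sqrtr // addr_ge0 ?sqr_ge0. Qed.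

Lemma hnrm_ge0 p q : 0 <= hnrm p q. Proof. exact: sqrtr_ge0. Qed.

Lemma hnrm_gt0 p q : (p != 0) || (q != 0) -> 0 < hnrm p q.
Proof.
rewrite -!cabs_gt0 sqrtr_gt0 => /orP[] h.
  by rewrite ltr_wpDr ?sqr_ge0 ?exprn_gt0.
by rewrite ltr_wpDl ?sqr_ge0 ?exprn_gt0.
Qed.

Lemma hnrmZ p q a : hnrm (p * a) (q * a) = hnrm p q * cabs a.
Proof.
rewrite /hnrm !cabsM !exprMn -mulrDl sqrtrM ?addr_ge0 ?sqr_ge0 //.
by rewrite sqrtr_sqr ger0_norm ?cabs_ge0.
Qed.

Lemma hnrm1 p : hnrm p 1 = Num.sqrt (1 + cabs p ^+ 2).
Proof. by rewrite /hnrm cabs1 expr1n addrC. Qed.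

Lemma hnrm_div p q : q != 0 -> Num.sqrt (1 + cabs (p / q) ^+ 2) = hnrm p q / cabs q.
Proof.
move=> q0; have := hnrmZ (p / q) 1 q; rewrite divfK // mul1r => ->.
by rewrite hnrm1 mulfK // cabs_eq0.
Qed.

Lemma hnrm0 p : hnrm p 0 = cabs p.
Proof. by rewrite /hnrm cabs0 expr0n addr0 sqrtr_sqr ger0_norm ?cabs_ge0. Qed.

(** One formula covers finite and infinite points. Symmetry, separation and the triangle inequality
    are read off from it by algebra. *)
Lemma chordal_pt p q r s : (p != 0) || (q != 0) -> (r != 0) || (s != 0) ->
  chordal (pt p q) (pt r s) = 2 * cabs (p * s - q * r) / (hnrm p q * hnrm r s).
Proof.
move=> hp hr; have np := hnrm_gt0 hp; have nr := hnrm_gt0 hr.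
move: hp hr np nr; rewrite /pt.
case: (eqVneq q 0) => [->|q0]; case: (eqVneq s 0) => [->|s0] /=; rewrite ?eqxx ?orbF => p0 r0 np nr.
- by rewrite mulr0 mul0r subr0 cabs0 mulr0 mul0r.
- rewrite (hnrm_div _ s0) mul0r subr0 hnrm0 cabsM.
  move: p0 s0; rewrite -!cabs_gt0 => ? ?; field.
  by rewrite !gt_eqF.
- rewrite (hnrm_div _ q0) mulr0 sub0r hnrm0 cabsN cabsM.
  move: r0 q0; rewrite -!cabs_gt0 => ? ?; field.
  by rewrite !gt_eqF.
- rewrite !hnrm_div //.
  have -> : p / q - r / s = (p * s - q * r) / (q * s) by field; rewrite q0 s0.
  rewrite cabs_div cabsM.
  move: s0 q0; rewrite -!cabs_gt0 => ? ?; field.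
  by rewrite !gt_eqF.
Qed.

Lemma pt_surj x : exists p q, ((p != 0) || (q != 0)) /\ x = pt p q.
Proof.
case: x => [a|]; [exists a, 1|exists 1, 0]; rewrite /pt ?eqxx oner_eq0 ?orbT //=.
by rewrite divr1.
Qed.

Lemma chordal_ge0 x y : 0 <= chordal x y.
Proof.
have [p [q [hp ->]]] := pt_surj x; have [r [s [hr ->]]] := pt_surj y.
by rewrite chordal_pt // !mulr_ge0 ?cabs_ge0 // invr_ge0 mulr_ge0 ?hnrm_ge0.
Qed.

Lemma chordalC x y : chordal x y = chordal y x.
Proof.
have [p [q [hp ->]]] := pt_surj x; have [r [s [hr ->]]] := pt_surj y.
rewrite !chordal_pt // -cabsN opprB [s * p]mulrC [r * q]mulrC [hnrm p q * _]mulrC.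
by rewrite [q * r]mulrC [p * s]mulrC.
Qed.

Lemma chordal_eq0 x y : chordal x y = 0 -> x = y.
Proof.
have [p [q [hp ->]]] := pt_surj x; have [r [s [hr ->]]] := pt_surj y.
rewrite chordal_pt // => /eqP; rewrite mulf_eq0 invr_eq0 !mulf_eq0 pnatr_eq0 /=.
rewrite ?[hnrm _ _ == 0]gt_eqF ?hnrm_gt0 // ?orbF cabs_eq0 subr_eq0 => /eqP h.
rewrite /pt; have [q0|q0] := eqVneq q 0; have [s0|s0] := eqVneq s 0 => //.
- move: h hp; rewrite q0 mul0r => /eqP; rewrite mulf_eq0 (negPf s0) orbF => ->.
  by rewrite eqxx.
- move: h hr; rewrite s0 mulr0 => /eqP; rewrite eq_sym mulf_eq0 (negPf q0) /= => ->.
  by rewrite eqxx.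
- congr Some; apply/eqP; rewrite eqr_div // h mulrC; by [].
Qed.

Lemma chordal_xx x : chordal x x = 0.
Proof. by case: x => //= a; rewrite subrr cabs0 mulr0 mul0r. Qed.

Lemma hnrm_CS a b p q : cabs (a * p + b * q) <= hnrm a b * hnrm p q.
Proof.
apply: le_trans (cabs_triangle _ _) _; rewrite !cabsM -ler_sqr ?nnegrE; last first.
- by rewrite mulr_ge0 ?hnrm_ge0.
- by rewrite addr_ge0 ?mulr_ge0 ?cabs_ge0.
rewrite exprMn !hnrm_sqr; have := sqr_ge0 (cabs a * cabs q - cabs b * cabs p); nra.
Qed.

Lemma hnrm_conj a b : hnrm (a^* ) (b^* ) = hnrm a b.
Proof. by rewrite /hnrm !cabs_conj. Qed.

Lemma chordal_triangle y x z : chordal x z <= chordal x y + chordal y z.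
Proof.
have [p [q [hp ->]]] := pt_surj x; have [r [s [hr ->]]] := pt_surj y.
have [a [b [ha ->]]] := pt_surj z.
rewrite !chordal_pt //.
move: (hnrm_gt0 hp) (hnrm_gt0 hr) (hnrm_gt0 ha) => np nr na.
(* For vectors x, y, z this expands det(x,z) |y|^2 as det(x,y) <y,z> + <y,x> det(y,z);
   Cauchy-Schwarz bounds the two scalar products. *)
have key : cabs (p * b - q * a) * hnrm r s ^+ 2 <=
   cabs (p * s - q * r) * (hnrm r s * hnrm a b) + (hnrm p q * hnrm r s) * cabs (r * b - s * a).
  have -> : cabs (p * b - q * a) * hnrm r s ^+ 2 =
     cabs ((p * s - q * r) * (r^* * a + s^* * b) + (r^* * p + s^* * q) * (r * b - s * a)).
    rewrite -[hnrm r s ^+ 2]cabs_rc_ge0 ?sqr_ge0 // hnrm_sqr rcD -!mulr_conj -cabsM.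
    by congr cabs; ring.
  apply: le_trans (cabs_triangle _ _) _; rewrite !cabsM.
  have h1 := hnrm_CS r^* s^* a b; have h2 := hnrm_CS r^* s^* p q.
  rewrite hnrm_conj in h1 h2.
  apply: lerD; first by rewrite ler_wpM2l ?cabs_ge0.
  by rewrite ler_wpM2r ?cabs_ge0 // mulrC mulrC [hnrm p q * _]mulrC.
have -> : 2 * cabs (p * s - q * r) / (hnrm p q * hnrm r s) +
   2 * cabs (r * b - s * a) / (hnrm r s * hnrm a b) =
   2 * (cabs (p * s - q * r) * (hnrm r s * hnrm a b) + (hnrm p q * hnrm r s) * cabs (r * b - s * a))
     / (hnrm r s ^+ 2 * (hnrm p q * hnrm a b)) by field; rewrite !gt_eqF.
rewrite ler_pdivlMr ?mulr_gt0 //.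
have -> : 2 * cabs (p * b - q * a) / (hnrm p q * hnrm a b) * (hnrm r s * hnrm r s * (hnrm p q * hnrm a b))
  = 2 * (cabs (p * b - q * a) * hnrm r s ^+ 2) by field; rewrite !gt_eqF.
by rewrite ler_pM2l.
Qed.

Lemma sqrt1_gt0 a : 0 < Num.sqrt (1 + cabs a ^+ 2).
Proof. by rewrite sqrtr_gt0 ltr_wpDr ?sqr_ge0. Qed.

Lemma sqrt1_ge1 a : 1 <= Num.sqrt (1 + cabs a ^+ 2).
Proof. by rewrite -[X in X <= _]sqrtr1 ler_wsqrtr // lerDl sqr_ge0. Qed.

Lemma sqrt1_ge a : cabs a <= Num.sqrt (1 + cabs a ^+ 2).
Proof.
by rewrite -[X in X <= _](ger0_norm (cabs_ge0 a)) -sqrtr_sqr ler_wsqrtr // lerDr.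
Qed.

Lemma sqrt1_le a : Num.sqrt (1 + cabs a ^+ 2) <= 1 + cabs a.
Proof.
rewrite -[X in _ <= X]ger0_norm ?addr_ge0 ?cabs_ge0 // -sqrtr_sqr ler_wsqrtr //.
by have := cabs_ge0 a; nra.
Qed.

Lemma nbhs_chordalP x (A : set S) :
  nbhs x A <-> exists2 e : R, 0 < e & forall y, chordal x y < e -> A y.
Proof.
case: x => [a|].
  split=> [/nbhs_cabsP[e e0 he]|[e e0 he]].
    pose n := Num.sqrt (1 + cabs a ^+ 2); have n0 : 0 < n := sqrt1_gt0 a.
    have a0 := cabs_ge0 a.
    have c0 : 0 < 1 + cabs a + e by lra.
    (* If [|v - a| >= e], the chordal distance is at least this, because [t / (1 + |a| + t)]
       increases with [t]. The second factor is below 1, which excludes infinity, at distance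
       [2 / n]. *)
    exists (2 / n * (e / (1 + cabs a + e))); first by rewrite !mulr_gt0 ?invr_gt0.
    case=> [v|]; last first.
      rewrite /chordal -/n => h; exfalso; move: h.
      rewrite ltr_pMr ?divr_gt0 // ltr_pdivlMr // mul1r; lra.
    rewrite /chordal -/n => h; apply: he; rewrite cabs_distC ltNge; apply/negP => ht.
    move: h; apply/negP; rewrite -leNgt.
    set m := Num.sqrt _; have m0 : 0 < m := sqrt1_gt0 v.
    have hm : m <= 1 + cabs a + cabs (a - v).
      apply: le_trans (sqrt1_le v) _.
      by have := cabs_lower v a; rewrite (cabs_distC v a); lra.
    have -> : 2 * cabs (a - v) / (n * m) = 2 / n * (cabs (a - v) / m) by field; rewrite !gt_eqF.
    rewrite ler_pM2l ?divr_gt0 // ler_pdivlMr // mulrAC ler_pdivrMr //.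
    nra.
  apply/nbhs_cabsP; exists (e / 2) => [|v hv]; first by lra.
  apply: he; rewrite /chordal; set n := Num.sqrt _; set m := Num.sqrt _.
  have n1 : 1 <= n := sqrt1_ge1 a; have m1 : 1 <= m := sqrt1_ge1 v.
  rewrite cabs_distC in hv; rewrite ltr_pdivrMr; last by rewrite mulr_gt0 //; lra.
  have : 1 <= n * m by nra.
  have := cabs_ge0 (a - v); nra.
split=> [[W [cW _] hW]|[e e0 he]].
  have [|M hM] := @compact_locally_bounded R C W (@cabs R) cW.
    move=> x _; exists (cabs x + 1); apply: filterS (near_cabs x ltr01) => y.
    by have := cabs_lower y x; lra.
  have M0 : 0 < 1 + `|M| by rewrite ltr_wpDr.
  exists (2 / (1 + `|M|)); first by rewrite divr_gt0.
  case=> [v|_]; last by apply: hW; right.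
  rewrite /chordal => h; apply: hW; left; exists v => // /hM hv.
  move: h; apply/negP; rewrite -leNgt ler_pM2l // lef_pV2 ?posrE ?sqrt1_gt0 //.
  by apply: le_trans (sqrt1_le v) _; have := ler_norm M; lra.
exists [set v : C | cabs (v - 0) <= 2 / e].
  split; first exact: compact_disc.
  apply: compact_closed; first exact: norm_hausdorff.
  exact: compact_disc.
move=> _ [[v /= hv <-]|->]; apply: he; last by rewrite chordal_xx.
rewrite /chordal ltr_pdivrMr ?sqrt1_gt0 // -ltr_pdivrMl // mulrC.
move/negP: hv; rewrite -ltNge subr0 => /lt_le_trans; apply; exact: sqrt1_ge.
Qed.

Lemma near_chordal x (e : R) : 0 < e -> \forall y \near x, chordal x y < e.
Proof. by move=> e0; apply/nbhs_chordalP; exists e. Qed.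

Lemma continuous_chordalP (T : topologicalType) (f : T -> S) (x : T) :
  {for x, continuous f} <->
  forall e : R, 0 < e -> \forall y \near x, chordal (f x) (f y) < e.
Proof.
split=> [hf e e0|hf A /nbhs_chordalP[e e0 he]].
  by apply: (hf [set v | chordal (f x) v < e]); exact: near_chordal.
by apply: filterS (hf _ e0) => y; exact: he.
Qed.

Lemma continuous_chordal x : continuous (chordal x).
Proof.
move=> u A /nbhs_ballP[e /= e0 he]; apply: filterS (near_chordal u e0) => v.
move=> hv; apply: he; apply: le_lt_trans hv; rewrite /= ler_norml.
have := chordal_triangle v x u; have := chordal_triangle u x v; rewrite (chordalC v u); lra.
Qed.

Lemma sphere_compact : compact [set: S].
Proof. exact: one_point_compactification_compact. Qed.

End Chordal.

(** * Polynomials near a point *)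

Section LocalPoly.
Variable R : realType.
Local Notation C := (Cplx R).
Implicit Types (p q n d B : {poly C}) (u v w : C).

Lemma near_horner p u (e : R) : 0 < e -> \forall v \near u, cabs (p.[v] - p.[u]) < e.
Proof.
elim/poly_ind: p e => [|p c IH] e e0.
  by apply: filterS (near_cabs u e0) => v _; rewrite !horner0 subrr cabs0.
have a0 := cabs_ge0 p.[u]; have b0 := cabs_ge0 u.
have h1 : 0 < e / 2 / (cabs u + 1) by rewrite !divr_gt0 //; lra.
have h2 : 0 < e / 2 / (cabs p.[u] + 1) by rewrite !divr_gt0 //; lra.
apply: filterS3 (IH _ h1) (near_cabs u h2) (near_cabs u ltr01) => v v1 v2 v3.
rewrite !hornerE.
have -> : p.[v] * v + c - (p.[u] * u + c) = (p.[v] - p.[u]) * v + p.[u] * (v - u) by ring.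
apply: le_lt_trans (cabs_triangle _ _) _; rewrite !cabsM.
have vu : cabs v <= cabs u + 1 by have := cabs_lower v u; lra.
move: v1 v2; rewrite !ltr_pdivlMr ?ltr_wpDl ?ltr01 // => v1 v2.
have := cabs_ge0 (p.[v] - p.[u]); have := cabs_ge0 (v - u); nra.
Qed.

Lemma near_horner_ge p u : p.[u] != 0 -> \forall v \near u, cabs p.[u] / 2 <= cabs p.[v].
Proof.
rewrite -cabs_gt0 => p0; have h0 : 0 < cabs p.[u] / 2 by lra.
apply: filterS (near_horner p u h0) => v.
by have := cabs_lower p.[u] p.[v]; rewrite cabs_distC; lra.
Qed.

Lemma near_horner_neq0 p u : p.[u] != 0 -> \forall v \near u, p.[v] != 0.
Proof.
move=> p0; apply: filterS (near_horner_ge p0) => v; rewrite -cabs_gt0.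
by apply: lt_le_trans; rewrite divr_gt0 ?cabs_gt0.
Qed.

Lemma near_horner_le p u : \forall v \near u, cabs p.[v] <= cabs p.[u] + 1.
Proof.
apply: filterS (near_horner p u ltr01) => v.
by have := cabs_lower p.[v] p.[u]; lra.
Qed.

Lemma near_neq_horner_neq0 p u : p != 0 -> \forall v \near u, v != u -> p.[v] != 0.
Proof.
move=> p0; have [m [B]] := multiplicity_XsubC p u; rewrite p0 => /= B0 ->.
apply: filterS (near_horner_neq0 B0) => v Bv vu.
by rewrite hornerM horner_exp hornerXsubC mulf_neq0 // expf_neq0 // subr_eq0.
Qed.

Lemma exists_near_neq u (e : R) : 0 < e -> exists v, v != u /\ cabs (v - u) < e.
Proof.
move=> e0; exists (u + rc (e / 2)).
have e2 : 0 < e / 2 by lra.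
rewrite -subr_eq0 addrAC subrr add0r cabs_rc_ge0 ?ltW //; split; last by lra.
by rewrite -cabs_gt0 cabs_rc_ge0 ?ltW.
Qed.

(** The expansion asked for by [is_branch_index], with leading coefficient [B(u) / d(u)^2]. The
    remainder gains a factor [v - u] because [B * d(u) - B(u) * d] vanishes at [u]. *)
Lemma quotient_expansion n d B u m : d.[u] != 0 ->
  n * (d.[u])%:P - (n.[u])%:P * d = B * ('X - u%:P) ^+ m ->
  exists K, \forall v \near u,
    cabs (n.[v] / d.[v] - (n.[u] / d.[u] + B.[u] / d.[u] ^+ 2 * (v - u) ^+ m))
      <= K * cabs ((v - u) ^+ m.+1).
Proof.
move=> d0 hB.
pose G := B * (d.[u])%:P - (B.[u])%:P * d.
have /factor_theorem[G' hG] : root G u.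
  by rewrite /root /G !hornerE mulrC subrr.
exists ((cabs G'.[u] + 1) / (cabs d.[u] / 2 * cabs d.[u] ^+ 2)).
have h1 := near_horner_le G' u; have h2 := near_horner_ge d0.
near=> v.
have dv2 : cabs d.[u] / 2 <= cabs d.[v] by near: v.
have Gv : cabs G'.[v] <= cabs G'.[u] + 1 by near: v.
have d0' : 0 < cabs d.[u] by rewrite cabs_gt0.
have dv : d.[v] != 0 by rewrite -cabs_gt0; lra.
have -> : n.[v] / d.[v] - (n.[u] / d.[u] + B.[u] / d.[u] ^+ 2 * (v - u) ^+ m) =
   G'.[v] / (d.[v] * d.[u] ^+ 2) * (v - u) ^+ m.+1.
  have e1 := congr1 (horner^~ v) hB; have e2 := congr1 (horner^~ v) hG.
  rewrite /G !hornerE /= in e1 e2.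
  have -> : G'.[v] / (d.[v] * d.[u] ^+ 2) * (v - u) ^+ m.+1 =
    (B.[v] * d.[u] - B.[u] * d.[v]) / (d.[v] * d.[u] ^+ 2) * (v - u) ^+ m.
    by rewrite e2 [_ ^+ m.+1]exprS; ring.
  have -> : (B.[v] * d.[u] - B.[u] * d.[v]) / (d.[v] * d.[u] ^+ 2) * (v - u) ^+ m =
     (B.[v] * (v - u) ^+ m) / (d.[v] * d.[u]) - B.[u] / d.[u] ^+ 2 * (v - u) ^+ m.
    by field; rewrite d0 dv.
  by rewrite -e1; field; rewrite d0 dv.
rewrite cabsM ler_wpM2r ?cabs_ge0 // cabs_div cabsM cabsX.
have s0 : 0 < cabs d.[u] ^+ 2 by rewrite exprn_gt0.
apply: ler_pM => //; rewrite ?cabs_ge0 ?invr_ge0 ?mulr_ge0 ?cabs_ge0 ?sqr_ge0 //.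
rewrite lef_pV2 ?posrE ?mulr_gt0 ?divr_gt0 //; last by lra.
by rewrite ler_wpM2r // ltW.
Unshelve. all: by end_near. Qed.

(** If [m > n], comparing the two expansions at [u + t] and dividing by [t^n] gives [|c| <= L * t]
    for small [t > 0], against [c != 0]. Used in both directions, it makes the branch index
    unique. *)
Lemma expansion_order_ge (h : C -> C) u (a c c' : C) (K K' : R) (n m : nat) : c != 0 ->
  (\forall v \near u, cabs (h v - (a + c * (v - u) ^+ n)) <= K * cabs ((v - u) ^+ n.+1)) ->
  (\forall v \near u, cabs (h v - (a + c' * (v - u) ^+ m)) <= K' * cabs ((v - u) ^+ m.+1)) ->
  (m <= n)%N.
Proof.
move=> c0 h1 h2; rewrite leqNgt; apply/negP => nm.
have [e e0 he] := (nbhs_cabsP _ _).1 (filterI h1 h2).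
pose L := `|K| + cabs c' + `|K'|.
have L0 : 0 <= L by rewrite !addr_ge0 ?cabs_ge0.
have c1 : 0 < cabs c by rewrite cabs_gt0.
pose t := Num.min (Num.min (e / 2) 1) (cabs c / (L + 1) / 2).
have t0 : 0 < t.
  by rewrite !lt_min ltr01 !divr_gt0 //; lra.
have te : t < e by rewrite gt_min gt_min ltr_pdivrMr // ltr_pMr // ltr1n.
have t1 : t <= 1 by rewrite !ge_min lexx orbT.
have tc : L * t < cabs c.
  have : t <= cabs c / (L + 1) / 2 by rewrite ge_min lexx orbT.
  rewrite ler_pdivlMr // ler_pdivlMr; [nra|lra].
have [] := he (u + rc t).
  by rewrite addrAC subrr add0r (cabs_rc_ge0 (ltW t0)).
rewrite [u + _ - _]addrAC subrr add0r !cabsX (cabs_rc_ge0 (ltW t0)).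
move: (h (u + rc t)) => hv k1 k2.
have tm : t ^+ m <= t ^+ n.+1 by apply: ler_wiXn2l => //; exact: ltW.
have tm1 : t ^+ m.+1 <= t ^+ n.+1 by apply: ler_wiXn2l => //; [exact: ltW|exact: leqW].
have p0 : 0 < t ^+ n.+1 by rewrite exprn_gt0.
have p1 : 0 < t ^+ m.+1 by rewrite exprn_gt0.
have p2 : 0 < t ^+ m by rewrite exprn_gt0.
have p3 : 0 < t ^+ n by rewrite exprn_gt0.
have : cabs c * t ^+ n <= L * t ^+ n.+1.
  have -> : cabs c * t ^+ n = cabs (hv - (a + c' * rc t ^+ m) - (hv - (a + c * rc t ^+ n)) + c' * rc t ^+ m).
    rewrite -[X in cabs c * X ^+ n](cabs_rc_ge0 (ltW t0)) -cabsX -cabsM.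
    by congr cabs; ring.
  apply: le_trans (cabs_triangle _ _) _.
  have := cabs_triangleB (hv - (a + c' * rc t ^+ m)) (hv - (a + c * rc t ^+ n)).
  rewrite [cabs (c' * _)]cabsM cabsX (cabs_rc_ge0 (ltW t0)) /L.
  have q1 : K * t ^+ n.+1 <= `|K| * t ^+ n.+1 by rewrite ler_wpM2r ?ler_norm ?ltW.
  have q2 : K' * t ^+ m.+1 <= `|K'| * t ^+ m.+1 by rewrite ler_wpM2r ?ler_norm ?ltW.
  have q3 : `|K'| * t ^+ m.+1 <= `|K'| * t ^+ n.+1 by rewrite ler_wpM2l.
  have q4 : cabs c' * t ^+ m <= cabs c' * t ^+ n.+1 by rewrite ler_wpM2l ?cabs_ge0.
  lra.
rewrite exprS mulrA ler_pM2r //; lra.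
Qed.

(** The open mapping theorem for [n / d] at [u]; the factorization over an algebraically closed
    field takes the place of Rouche's theorem. *)
Lemma horner_quotient_open n d u : d.[u] != 0 -> n * (d.[u])%:P - (n.[u])%:P * d != 0 ->
  forall rho : R, 0 < rho -> exists2 eta : R, 0 < eta & forall w,
    cabs (w - n.[u] / d.[u]) < eta -> exists2 v, cabs (v - u) < rho & n.[v] = w * d.[v].
Proof.
move=> d0 A0 rho rho0; set h0 := n.[u] / d.[u].
have [e e0 he] := (nbhs_cabsP _ _).1 (near_neq_horner_neq0 u A0).
have [|u1 [u1u]] := exists_near_neq u (e := Num.min e rho); first by rewrite lt_min e0.
rewrite lt_min => /andP[u1e u1rho].
have A1 : n.[u1] - h0 * d.[u1] != 0.
  have := he _ u1e u1u; rewrite !hornerE /= => h; apply: contra h.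
  by rewrite /h0 => /eqP h; apply/eqP; rewrite -(mul0r d.[u]) -h; field.
pose N := maxn (size n) (size d).
(* Without a root near [u], the estimates [k1], [k2], [k3] below bound [|n(u1) - h0 d(u1)|] by
   [|w - h0|] times the first two summands; the third makes [den] positive. *)
pose den := 2 ^+ N * cabs d.[u] + cabs d.[u1] + 1.
have den0 : 0 < den by rewrite ltr_wpDl // addr_ge0 ?mulr_ge0 ?cabs_ge0 ?exprn_ge0.
exists (cabs (n.[u1] - h0 * d.[u1]) / den) => [|w hw]; first by rewrite divr_gt0 ?cabs_gt0.
(* If no root of [n - w d] is within [rho] of [u], each factor at most doubles
   from [u] to [u1]. *)
apply: contrapT => noroot.
pose Aw := n - w *: d.
have AwE v : Aw.[v] = n.[v] - w * d.[v] by rewrite /Aw !hornerE.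
have [rs Ars] := closed_field_poly_normal Aw.
have rsbig r : r \in rs -> rho <= cabs (r - u).
  move=> rin; rewrite leNgt; apply/negP => rrho; apply: noroot; exists r => //.
  apply/eqP; rewrite -subr_eq0 -AwE Ars hornerZ horner_prod.
  by rewrite (big_rem r) //= hornerXsubC subrr mul0r mulr0.
have szrs : (size rs <= N)%N.
  have [Aw0|Aw0] := eqVneq Aw 0.
    exfalso; apply: noroot; exists u; rewrite ?subrr ?cabs0 //.
    by apply/eqP; rewrite -subr_eq0 -AwE Aw0 horner0.
  have : size Aw = (size rs).+1.
    by rewrite Ars size_scale ?lead_coef_eq0 // size_prod_XsubC.
  have : (size Aw <= N)%N.
    rewrite /Aw; apply: leq_trans (size_polyD _ _) _; rewrite size_polyN geq_max leq_maxl /=.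
    by apply: leq_trans (size_scale_leq _ _) _; rewrite leq_maxr.
  by move=> h1 h2; rewrite h2 in h1; exact: ltnW.
have k1 : cabs Aw.[u1] <= 2 ^+ N * cabs Aw.[u].
  have : cabs Aw.[u1] <= 2 ^+ size rs * cabs Aw.[u].
    rewrite [in X in _ <= X]Ars [in X in X <= _]Ars !hornerZ !horner_prod !cabsM mulrCA ler_wpM2l ?cabs_ge0 //.
    rewrite !cabs_prod; elim: rs rsbig {Ars szrs} => [|r rs IH] hr.
      by rewrite !big_nil expr0 mul1r.
    rewrite !big_cons !hornerXsubC /= exprS mulrACA; apply: ler_pM; rewrite ?cabs_ge0 ?prodr_ge0 //.
    - by move=> *; exact: cabs_ge0.
    - have := hr r (mem_head _ _); have := cabs_triangle (u1 - u) (u - r).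
      by rewrite addrA subrK (cabs_distC r u); lra.
    - by apply: IH => s sin; apply: hr; rewrite inE sin orbT.
  move/le_trans; apply; rewrite ler_wpM2r ?cabs_ge0 //.
  by apply: ler_weXn2l => //; rewrite ler1n.
have k2 : cabs Aw.[u] = cabs (w - h0) * cabs d.[u].
  rewrite AwE -cabsM -cabsN; congr cabs; rewrite mulrBl /h0 divfK //; ring.
have k3 : cabs (n.[u1] - h0 * d.[u1]) <= cabs Aw.[u1] + cabs (w - h0) * cabs d.[u1].
  rewrite AwE -cabsM; apply: le_trans (cabs_triangle _ _).
  by rewrite le_eqVlt; apply/orP; left; apply/eqP; congr cabs; ring.
move: hw; rewrite ltr_pdivlMr // /den.
have := cabs_ge0 (w - h0); nra.
Qed.

(** Both points vary, and the error is measured against [|v - w|] rather than the distance to [u];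
    local injectivity rests on this. *)
Lemma horner_strict_diff p u (e : R) : 0 < e ->
  exists2 del : R, 0 < del & forall v w, cabs (v - u) < del -> cabs (w - u) < del ->
    cabs (p.[v] - p.[w] - (v - w) * p^`().[u]) <= e * cabs (v - w).
Proof.
suff [D [hD hD']] : exists D : C -> C -> C, (forall v w, p.[v] - p.[w] = (v - w) * D v w) /\
   forall e : R, 0 < e -> exists2 del : R, 0 < del &
     forall v w, cabs (v - u) < del -> cabs (w - u) < del -> cabs (D v w - p^`().[u]) < e.
  move=> /hD'[del del0 hdel]; exists del => // v w hv hw.
  by rewrite hD -mulrBr cabsM mulrC ler_wpM2r ?cabs_ge0 // ltW // hdel.
elim/poly_ind: p {e} => [|p c [D [hD hD']]].
  exists (fun _ _ => 0); split=> [v w|e e0]; first by rewrite !horner0 subrr mulr0.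
  by exists 1 => // v w _ _; rewrite deriv0 horner0 subrr cabs0.
exists (fun v w => p.[v] + w * D v w); split=> [v w|e e0].
  rewrite !hornerE mulrDr [_ * (w * _)]mulrCA -hD; ring.
rewrite derivMXaddC !hornerE.
have a0 := cabs_ge0 u; have b0 := cabs_ge0 p^`().[u].
have e1 : 0 < e / 3 / (cabs u + 1) by rewrite !divr_gt0 //; lra.
have e2 : 0 < e / 3 by lra.
have [d1 d10 h1] := hD' _ e1.
have [d2 d20 h2] := (nbhs_cabsP _ _).1 (near_horner p u e2).
exists (Num.min (Num.min d1 d2) (Num.min 1 (e / 3 / (cabs p^`().[u] + 1)))).
  by rewrite !lt_min d10 d20 ltr01 /= !divr_gt0 //; lra.
move=> v w; rewrite !lt_min => /andP[/andP[v1 v2] /andP[v3 v4]] /andP[/andP[w1 w2] /andP[w3 w4]].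
have -> : p.[v] + w * D v w - (p.[u] + p^`().[u] * u) =
  (p.[v] - p.[u]) + w * (D v w - p^`().[u]) + (w - u) * p^`().[u] by ring.
apply: le_lt_trans (cabs_triangle _ _) _.
have t1 := cabs_triangle (p.[v] - p.[u]) (w * (D v w - p^`().[u])).
rewrite !cabsM in t1 *.
have k1 := h1 _ _ v1 w1; have k2 := h2 _ v2.
have wu : cabs w <= cabs u + 1 by have := cabs_lower w u; lra.
move: k1 w4; rewrite !ltr_pdivlMr ?ltr_wpDl ?ltr01 // => k1 w4.
have := cabs_ge0 (D v w - p^`().[u]); have := cabs_ge0 (w - u); nra.
Qed.

Lemma hnrm_gel (p q : C) : cabs p <= hnrm p q.
Proof.
by rewrite -[X in X <= _](ger0_norm (cabs_ge0 p)) -sqrtr_sqr ler_wsqrtr // lerDl sqr_ge0.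
Qed.

Lemma hnrm_ger (p q : C) : cabs q <= hnrm p q.
Proof.
by rewrite -[X in X <= _](ger0_norm (cabs_ge0 q)) -sqrtr_sqr ler_wsqrtr // lerDr sqr_ge0.
Qed.

Lemma near_hnrm_ge p q u : (p.[u] != 0) || (q.[u] != 0) ->
  exists2 k : R, 0 < k & \forall v \near u, k <= hnrm p.[v] q.[v].
Proof.
case/orP => h.
  exists (cabs p.[u] / 2); first by rewrite divr_gt0 ?cabs_gt0.
  by apply: filterS (near_horner_ge h) => v /le_trans; apply; exact: hnrm_gel.
exists (cabs q.[u] / 2); first by rewrite divr_gt0 ?cabs_gt0.
by apply: filterS (near_horner_ge h) => v /le_trans; apply; exact: hnrm_ger.
Qed.

Lemma hnrm_gt0_neq0 (a b : C) : 0 < hnrm a b -> (a != 0) || (b != 0).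
Proof.
move=> h; rewrite -negb_and; apply: contraTN h => /andP[/eqP -> /eqP ->].
by rewrite hnrm0 cabs0 ltxx.
Qed.

Lemma chordal_pt_le p q u : (p.[u] != 0) || (q.[u] != 0) ->
  exists2 K : R, 0 < K & \forall v \near u, ((p.[v] != 0) || (q.[v] != 0)) /\
    chordal (pt p.[u] q.[u]) (pt p.[v] q.[v]) <= K * cabs (p.[v] * q.[u] - p.[u] * q.[v]).
Proof.
move=> h; have [k k0 hk] := near_hnrm_ge h; have n0 := hnrm_gt0 h.
exists (2 / (hnrm p.[u] q.[u] * k)); first by rewrite divr_gt0 ?mulr_gt0.
apply: filterS hk => v hv.
have nv : 0 < hnrm p.[v] q.[v] by lra.
have hv0 := hnrm_gt0_neq0 nv.
split=> //; rewrite chordal_pt // [X in _ * cabs X](_ : _ = - (p.[v] * q.[u] - p.[u] * q.[v])); last by ring.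
rewrite cabsN mulrAC ler_wpM2r ?cabs_ge0 // ler_wpM2l // lef_pV2 ?posrE ?mulr_gt0 //.
by rewrite ler_pM2l.
Qed.

Lemma continuous_pt p q u : (p.[u] != 0) || (q.[u] != 0) ->
  {for u, continuous (fun v => pt p.[v] q.[v])}.
Proof.
move=> h; apply/continuous_chordalP => e e0; have [K K0 hK] := chordal_pt_le h.
have h0 : 0 < e / K by rewrite divr_gt0.
have := near_horner (p * (q.[u])%:P - (p.[u])%:P * q) u h0.
apply: filterS2 hK => v [_ hv]; rewrite !hornerE /=.
rewrite subrr subr0 ltr_pdivlMr // mulrC; exact: le_lt_trans.
Qed.

End LocalPoly.

(** * Charts and homogenization *)

Section Charts.
Variable R : realType.
Local Notation C := (Cplx R).
Local Notation S := (sphere R).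
Implicit Types (x y z : S) (u v w : C).

(** With [chart_den], the homogeneous coordinates of [chart_inv x u] as polynomials in [u]; they
    depend only on whether [x] is infinite. *)
Definition chart_num x : {poly C} := if x is Some _ then 'X else 1.
Definition chart_den x : {poly C} := if x is Some _ then 1 else 'X.

Lemma chart_num_den_neq0 x u : ((chart_num x).[u] != 0) || ((chart_den x).[u] != 0).
Proof. by case: x => [a|] /=; rewrite hornerC oner_eq0 ?orbT. Qed.

Lemma chart_inv_pt x u : chart_inv x u = pt (chart_num x).[u] (chart_den x).[u].
Proof.
case: x => [a|] /=; rewrite /pt hornerX hornerC ?oner_eq0 ?divr1 //.
by case: eqP => // _; rewrite div1r.
Qed.

Lemma chartK x : chart_inv x (chart x x) = x.
Proof. by case: x => [a|] //=; rewrite eqxx. Qed.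

Lemma chart_invK x u : chart x (chart_inv x u) = u.
Proof. by case: x => [a|] //=; case: eqP => [->|_] //=; rewrite invrK. Qed.

Lemma continuous_chart_inv x : continuous (chart_inv x).
Proof.
move=> u; rewrite (_ : chart_inv x = fun v => pt (chart_num x).[v] (chart_den x).[v]).
  by apply: continuous_pt; exact: chart_num_den_neq0.
by apply/funext => v; rewrite chart_inv_pt.
Qed.

Lemma chart_lipschitz x : exists2 K : R, 0 < K & \forall y \near x,
  chart_inv x (chart x y) = y /\ cabs (chart x y - chart x x) <= K * chordal x y.
Proof.
case: x => [a|].
  have a0 := cabs_ge0 a; have na := sqrt1_gt0 a.
  exists (Num.sqrt (1 + cabs a ^+ 2) * (2 + cabs a) / 2).
    by rewrite divr_gt0 // mulr_gt0 //; lra.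
  have := @one_point_compactification_some_nbhs C a _ (near_cabs a ltr01).
  apply: filterS => _ [v /= va <-]; split=> //.
  rewrite /chordal (cabs_distC a v); have nv := sqrt1_gt0 v.
  have -> : Num.sqrt (1 + cabs a ^+ 2) * (2 + cabs a) / 2 *
     (2 * cabs (v - a) / (Num.sqrt (1 + cabs a ^+ 2) * Num.sqrt (1 + cabs v ^+ 2))) =
     cabs (v - a) * ((2 + cabs a) / Num.sqrt (1 + cabs v ^+ 2)).
    by field; rewrite !gt_eqF.
  rewrite ler_peMr ?cabs_ge0 // ler_pdivlMr // mul1r.
  by apply: le_trans (sqrt1_le v) _; have := cabs_lower v a; lra.
exists 1 => //; apply: filterS (near_chordal None ltr01) => -[v|_]; last first.
  by rewrite /chart /chart_inv eqxx subrr cabs0 chordal_xx mulr0.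
rewrite mul1r /chordal => hv; have nv := sqrt1_gt0 v.
rewrite ltr_pdivrMr // mul1r in hv; have lv := sqrt1_le v.
have v1 : 1 < cabs v by lra.
have v0 : v != 0 by rewrite -cabs_gt0; lra.
rewrite /chart /chart_inv invr_eq0 (negPf v0) invrK; split=> //.
rewrite subr0 cabsV ler_pdivlMr // mulrC ler_pdivrMr; lra.
Qed.

(** Carries local statements on the sphere, infinity included, to one complex variable. *)
Lemma near_chart x (P : S -> Prop) :
  (\forall u \near chart x x, P (chart_inv x u)) -> \forall y \near x, P y.
Proof.
move=> /nbhs_cabsP[e e0 he]; have [K K0 hK] := chart_lipschitz x.
have h0 : 0 < e / K by rewrite divr_gt0.
apply: filterS2 hK (near_chordal x h0) => y [yE hy] yx; rewrite -yE; apply: he.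
apply: le_lt_trans hy _.
by rewrite mulrC -ltr_pdivlMr.
Qed.

Lemma sphere_perfect x (e : R) : 0 < e -> exists2 y, y != x & chordal x y < e.
Proof.
move=> e0; have /continuous_chordalP/(_ _ e0) := @continuous_chart_inv x (chart x x).
rewrite chartK => /nbhs_cabsP[d d0 hd].
have [u [ux ud]] := exists_near_neq (chart x x) d0.
exists (chart_inv x u); last exact: hd.
by apply: contra ux => /eqP h; rewrite -(chart_invK x u) h.
Qed.

Lemma chart_inv_range x : exists z, forall y, y != z -> exists u, y = chart_inv x u.
Proof.
case: x => [a|]; [exists None|exists (Some 0)] => -[v|] //= hv.
- by exists v.
- exists v^-1; rewrite invr_eq0 invrK; case: eqP => // v0.
  by rewrite v0 eqxx in hv.
- by exists 0; rewrite eqxx.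
Qed.

Lemma pt_eqP (p q r s : C) : (p != 0) || (q != 0) -> (r != 0) || (s != 0) ->
  (pt p q = pt r s) <-> p * s = q * r.
Proof.
move=> h1 h2; have := chordal_pt h1 h2.
have n1 := hnrm_gt0 h1; have n2 := hnrm_gt0 h2; split=> h.
  move: H; rewrite h chordal_xx => /esym/eqP.
  rewrite mulf_eq0 invr_eq0 !mulf_eq0 pnatr_eq0 (gt_eqF n1) (gt_eqF n2) /= orbF.
  by rewrite cabs_eq0 subr_eq0 => /eqP.
by apply: chordal_eq0; rewrite H h subrr cabs0 mulr0 mul0r.
Qed.

Lemma bigO_cabsP (h g e : C -> C) u :
  (h = g +O_ (nbhs u) e) <->
  exists K : R, \forall v \near u, cabs (h v - g v) <= K * cabs (e v).
Proof.
split.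
  move=> /eqaddOP/bigO_exP[k k0 hk]; exists (cabs (k : C)).
  apply: filterS hk => v; rewrite -cabsM -lecabs normrM.
  by rewrite [`|k|]gtr0_norm.
move=> [K hK]; apply/eqaddOP/bigO_exP; exists (rc (`|K| + 1)).
  by rewrite /rc ltcR ltr_wpDl.
apply: filterS hK => v hv; rewrite -[in X in _ <= X * _](ger0_norm (x := rc (`|K| + 1))).
  rewrite -normrM lecabs cabsM cabs_rc_ge0 ?addr_ge0 //.
  apply: le_trans hv _; rewrite ler_wpM2r ?cabs_ge0 //.
  by have := ler_norm K; lra.
by rewrite /rc ler0c addr_ge0.
Qed.

End Charts.

(** * Homogenization of polynomials *)

Section Homogenization.
Variable A : comNzRingType.

(** For [P] of degree at most [d] and [y != 0] this is [y^d * P(x / y)]; having no division, it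
    makes sense at [y = 0] as well. *)
Definition homog (P : {poly A}) (d : nat) (x y : A) : A :=
  \sum_(i < d.+1) P`_i * (x ^+ i * y ^+ (d - i)).

Definition homog_poly (P : {poly A}) (d : nat) (p q : {poly A}) : {poly A} :=
  \sum_(i < d.+1) P`_i *: (p ^+ i * q ^+ (d - i)).

Lemma horner_homog_poly P d p q u :
  (homog_poly P d p q).[u] = homog P d p.[u] q.[u].
Proof.
rewrite /homog_poly horner_sum; apply: eq_bigr => i _.
by rewrite hornerZ hornerM !horner_exp.
Qed.

Lemma homogx0 P d x : homog P d x 0 = P`_d * x ^+ d.
Proof.
rewrite /homog big_ord_recr /= subnn expr0 mulr1 big1 ?add0r // => i _.
by rewrite expr0n subn_eq0 leqNgt ltn_ord /= !mulr0.
Qed.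

Lemma homog_poly_X (P : {poly A}) d : (size P <= d.+1)%N -> homog_poly P d 'X 1 = P.
Proof.
move=> hP; rewrite /homog_poly; apply/polyP => k.
under eq_bigr => i _ do rewrite expr1n mulr1.
rewrite -poly_def coef_poly; case: ltnP => // dk.
by rewrite nth_default // (leq_trans hP).
Qed.

End Homogenization.

Lemma homog_div (F : fieldType) (P : {poly F}) d x y : (size P <= d.+1)%N -> y != 0 ->
  homog P d x y = y ^+ d * P.[x / y].
Proof.
move=> hP y0; rewrite (horner_coef_wide _ hP) mulr_sumr; apply: eq_bigr => i _.
have id : (i <= d)%N by rewrite -ltnS.
have -> : y ^+ d = y ^+ (d - i) * y ^+ i by rewrite -exprD subnK.
rewrite expr_div_n.
have : y ^+ i != 0 by rewrite expf_neq0.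
by move=> ?; field.
Qed.

Lemma size_homog_poly (A : idomainType) (P : {poly A}) d (p q : {poly A}) :
  (size p <= 2)%N -> (size q <= 2)%N -> (p == 1) || (q == 1) ->
  (size (homog_poly P d p q) <= d.+1)%N.
Proof.
move=> hp hq hpq; apply: leq_trans (size_sum _ _ _) _; apply/bigmax_leqP => i _.
apply: leq_trans (size_scale_leq _ _) _.
have id : (i <= d)%N by rewrite -ltnS.
have pow (r : {poly A}) k : (size r <= 2)%N -> (size (r ^+ k) <= k.+1)%N.
  move=> hr; apply: leq_trans (size_poly_exp_leq _ _) _; rewrite ltnS.
  rewrite -[X in (_ <= X)%N]mul1n leq_mul2r; apply/orP; right.
  by case: (size r) hr.
case/orP: hpq => /eqP ->; rewrite expr1n ?mul1r ?mulr1; apply: leq_trans (pow _ _ _) _ => //.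
by rewrite ltnS leq_subr.
Qed.

(** * Branch indices of rational maps *)

Section RationalMaps.
Variables (R : realType) (f : ratfun R).
Local Notation C := (Cplx R).
Local Notation S := (sphere R).
Implicit Types (x y z : S) (u v w : C).
Local Notation P := (rnum f).
Local Notation Q := (rden f).

Definition ratdeg := (maxn (size P) (size Q)).-1.
Local Notation d := ratdeg.

Lemma size_rnum_le : (size P <= d.+1)%N.
Proof. by apply: leq_trans (leqSpred _); rewrite leq_maxl. Qed.

Lemma size_rden_le : (size Q <= d.+1)%N.
Proof. by apply: leq_trans (leqSpred _); rewrite leq_maxr. Qed.

(** At a finite point this is coprimality; at infinity it says that [P] or [Q] has degree exactly
    [d]. *)
Lemma homog_ratfun_neq0 a b : (a != 0) || (b != 0) ->
  (homog P d a b != 0) || (homog Q d a b != 0).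
Proof.
have [->|b0 _] := eqVneq b 0.
  rewrite orbF => a0; rewrite !homogx0 !mulf_eq0 !expf_eq0 (negPf a0) !andbF !orbF.
  rewrite /ratdeg; case: (leqP (size P) (size Q)) => h.
    by rewrite -lead_coefE lead_coef_eq0 rden_neq0 orbT.
  by rewrite -lead_coefE lead_coef_eq0 -size_poly_gt0 (leq_ltn_trans _ h).
rewrite (homog_div _ size_rnum_le b0) (homog_div _ size_rden_le b0).
rewrite !mulf_eq0 expf_eq0 (negPf b0) andbF /= -negb_and.
apply/negP => /andP[p0 q0].
by have := coprimep_root (rcoprime f) p0; rewrite (eqP q0) eqxx.
Qed.

Lemma ratmap_pt a b : (a != 0) || (b != 0) ->
  f (pt a b) = pt (homog P d a b) (homog Q d a b).
Proof.
rewrite {1}/pt; have [->|b0 _] := eqVneq b 0.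
  rewrite orbF => a0; have ad : a ^+ d != 0 by rewrite expf_neq0.
  rewrite !homogx0 /pt /= /ratdeg mulf_eq0; case: (leqP (size P) (size Q)) => h.
    rewrite -lead_coefE lead_coef_eq0 (negPf (rden_neq0 f)) expf_eq0 (negPf a0) andbF /=.
    have aq : a ^+ (size Q).-1 != 0 by rewrite expf_neq0.
    by rewrite -mulf_div divff // mulr1.
  rewrite [Q`__]nth_default ?eqxx //.
  by rewrite -ltnS (ltn_predK h).
rewrite (homog_div _ size_rnum_le b0) (homog_div _ size_rden_le b0) /= /pt.
have bd : b ^+ d != 0 by rewrite expf_neq0.
rewrite mulf_eq0 (negPf bd) /=; case: eqP => // _.
by rewrite -mulf_div divff // mul1r.
Qed.

Definition lift_num x := homog_poly P d (chart_num x) (chart_den x).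
Definition lift_den x := homog_poly Q d (chart_num x) (chart_den x).

(** This is the form in which the iterates meet the maximum principle and Hurwitz' theorem. *)
Lemma iter_lift x n : exists p q : {poly C},
  (forall u, (p.[u] != 0) || (q.[u] != 0)) /\
  forall u, iter n f (chart_inv x u) = pt p.[u] q.[u].
Proof.
elim: n => [|n [p [q [h1 h2]]]].
  exists (chart_num x), (chart_den x); split=> u; first exact: chart_num_den_neq0.
  exact: chart_inv_pt.
exists (homog_poly P d p q), (homog_poly Q d p q); split=> u.
  by rewrite !horner_homog_poly homog_ratfun_neq0.
by rewrite iterS h2 ratmap_pt // !horner_homog_poly.
Qed.

Lemma lift_neq0 x u : ((lift_num x).[u] != 0) || ((lift_den x).[u] != 0).
Proof. by rewrite !horner_homog_poly homog_ratfun_neq0 // chart_num_den_neq0. Qed.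

Lemma ratmap_lift x u : f (chart_inv x u) = pt (lift_num x).[u] (lift_den x).[u].
Proof.
by rewrite chart_inv_pt ratmap_pt ?chart_num_den_neq0 // !horner_homog_poly.
Qed.

Lemma size_lift_num x : (size (lift_num x) <= d.+1)%N.
Proof.
by apply: size_homog_poly; case: x => [a|] /=; rewrite ?size_polyX ?size_poly1 ?eqxx ?orbT.
Qed.

Lemma size_lift_den x : (size (lift_den x) <= d.+1)%N.
Proof.
by apply: size_homog_poly; case: x => [a|] /=; rewrite ?size_polyX ?size_poly1 ?eqxx ?orbT.
Qed.

Lemma lift_num_Some a : lift_num (Some a) = P.
Proof. by rewrite /lift_num homog_poly_X // size_rnum_le. Qed.

Lemma lift_den_Some a : lift_den (Some a) = Q.
Proof. by rewrite /lift_den homog_poly_X // size_rden_le. Qed.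

Lemma ratmap_continuous : continuous (f : S -> S).
Proof.
move=> x; apply/continuous_chordalP => e e0; apply: near_chart.
rewrite (_ : f x = pt (lift_num x).[chart x x] (lift_den x).[chart x x]); last first.
  by rewrite -ratmap_lift chartK.
have /continuous_chordalP/(_ _ e0) := continuous_pt (lift_neq0 x (chart x x)).
by apply: filterS => u; rewrite ratmap_lift.
Qed.

Lemma iter_ratmap_continuous n : continuous (iter n f : S -> S).
Proof.
elim: n => [|n IH] x; first by move=> A.
by apply: continuous_comp; [exact: IH|exact: ratmap_continuous].
Qed.

(* The numerator, in the chart at [x], of [f - f x]. *)
Definition lift_cross x : {poly C} :=
  lift_num x * ((lift_den x).[chart x x])%:P - ((lift_num x).[chart x x])%:P * lift_den x.

Lemma lift_crossE x u : (lift_cross x).[u] =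
  (lift_num x).[u] * (lift_den x).[chart x x] - (lift_num x).[chart x x] * (lift_den x).[u].
Proof. by rewrite /lift_cross !hornerE. Qed.

Lemma size_lift_cross x : (size (lift_cross x) <= d.+1)%N.
Proof.
rewrite /lift_cross; apply: leq_trans (size_polyD _ _) _.
rewrite size_polyN geq_max mulrC !mul_polyC.
by rewrite !(leq_trans (size_scale_leq _ _)) ?size_lift_num ?size_lift_den.
Qed.

Hypothesis hf : nonconstant f.

Lemma lift_cross_neq0 x : lift_cross x != 0.
Proof.
apply/eqP => A0; apply: hf; exists (f x).
have fE u : f (chart_inv x u) = f x.
  rewrite -{2}(chartK x) !ratmap_lift; apply/pt_eqP; rewrite ?lift_neq0 //.
  by apply/eqP; rewrite -subr_eq0 [_ * (lift_num x).[_]]mulrC -lift_crossE A0 horner0.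
(* The chart misses the point [z0]; the value there follows by continuity, since [z0] is not
   isolated. *)
have [z0 hz0] := chart_inv_range x.
have fE' y : y != z0 -> f y = f x by move=> /hz0[u ->].
move=> z; have [->|/fE'//] := eqVneq z z0.
apply/chordal_eq0/eqP; rewrite eq_le chordal_ge0 andbT leNgt; apply/negP => h0.
have /continuous_chordalP/(_ _ h0) := @ratmap_continuous z0.
move=> /nbhs_chordalP[e e0 he]; have [y yz0 /he] := sphere_perfect z0 e0.
by rewrite (fE' _ yz0) ltxx.
Qed.

(** The multiplicity [m] will be the branch index. It is positive because [lift_cross x] vanishes at
    the centre of the chart, and at most [d] by degree. *)
Lemma lift_crossP x : exists B m, [/\ B.[chart x x] != 0, (1 <= m <= d)%N &
  lift_cross x = B * ('X - (chart x x)%:P) ^+ m].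
Proof.
have [m [B]] := multiplicity_XsubC (lift_cross x) (chart x x).
rewrite lift_cross_neq0 => /= B0 hA; exists B, m; split=> //.
have Bn0 : B != 0 by apply: contraNneq B0 => ->; rewrite root0.
apply/andP; split.
  rewrite lt0n; apply: contra B0 => /eqP m0.
  by move: hA; rewrite m0 expr0 mulr1 => <-; rewrite /root lift_crossE mulrC subrr.
have := size_lift_cross x; rewrite hA size_Mmonic ?monic_exp ?monicXsubC //.
have : (0 < size B)%N by rewrite size_poly_gt0.
rewrite size_exp_XsubC addnS /=; move: (size B) => k k0 kd.
by rewrite -ltnS; apply: leq_trans kd; rewrite -add1n leq_add2r.
Qed.

(* Near [f x] the map is, in charts, a quotient [n / dn] with [dn] nonzero; the
   numerator and the denominator are exchanged when [f x] is infinite. *)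
Lemma local_quotient x : let u0 := chart x x in
  exists (n dn : {poly C}) (s : C),
  [/\ dn.[u0] != 0, s != 0,
   n * (dn.[u0])%:P - (n.[u0])%:P * dn = s *: lift_cross x,
   (forall u, dn.[u] != 0 -> local_rep f x u = n.[u] / dn.[u]) &
   (forall u w, dn.[u] != 0 -> n.[u] = w * dn.[u] ->
     f (chart_inv x u) = chart_inv (f x) w)].
Proof.
move=> u0; have fx : f x = pt (lift_num x).[u0] (lift_den x).[u0].
  by rewrite -ratmap_lift chartK.
rewrite /local_rep; have [q0|q0] := eqVneq (lift_den x).[u0] 0.
  have p0 : (lift_num x).[u0] != 0.
    by have := lift_neq0 x u0; rewrite q0 eqxx orbF.
  exists (lift_den x), (lift_num x), (-1).
  have -> : f x = None by rewrite fx /pt q0 eqxx.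
  split=> //.
  - by rewrite /lift_cross -/u0 scaleN1r; ring.
  - move=> u pu; rewrite ratmap_lift /pt; case: eqP => [->|_]; first by rewrite mul0r.
    by rewrite /= invf_div.
  - move=> u w pu qw; rewrite ratmap_lift /pt qw mulf_eq0 (negPf pu) orbF /=.
    case: eqVneq => // w0; congr Some; field; by rewrite pu w0.
exists (lift_num x), (lift_den x), 1.
have -> : f x = Some ((lift_num x).[u0] / (lift_den x).[u0]) by rewrite fx /pt (negPf q0).
split=> //; rewrite ?oner_eq0 ?scale1r //.
- by move=> u qu; rewrite ratmap_lift /pt (negPf qu).
- by move=> u w qu pw; rewrite ratmap_lift /pt (negPf qu) /= pw mulfK.
Qed.

(** Since [branch_index] is an [xget], the order of the expansion has to be shown both to exist and
    to be unique. *)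
Lemma branch_index_lift x B m : B.[chart x x] != 0 ->
  lift_cross x = B * ('X - (chart x x)%:P) ^+ m -> (1 <= m)%N ->
  branch_index f x = m.
Proof.
move=> B0 hA m1; have [n [dn [s [dn0 s0 hn hrep _]]]] := local_quotient x.
set u0 := chart x x in B0 hA dn0 hn hrep *.
rewrite hA scalerAl in hn.
have [K hK] := quotient_expansion dn0 hn.
have rep0 : local_rep f x u0 = n.[u0] / dn.[u0] by exact: hrep.
have hK' : \forall v \near u0, cabs (local_rep f x v - (local_rep f x u0 +
    (s *: B).[u0] / dn.[u0] ^+ 2 * (v - u0) ^+ m)) <= K * cabs ((v - u0) ^+ m.+1).
  by apply: filterS2 hK (near_horner_neq0 dn0) => v hv dv; rewrite rep0 hrep.
have c0 : (s *: B).[u0] / dn.[u0] ^+ 2 != 0.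
  by rewrite mulf_neq0 ?invr_eq0 ?expf_neq0 // hornerZ mulf_neq0.
have isb : is_branch_index f x m.
  split=> //; exists ((s *: B).[u0] / dn.[u0] ^+ 2); split=> //.
  by apply/bigO_cabsP; exists K.
rewrite /branch_index; case: xgetP => [k _ [k1 [c [cn0 /bigO_cabsP[K' hc]]]]|/(_ m)//].
apply/eqP; rewrite eqn_leq.
by rewrite (expansion_order_ge c0 hK' hc) (expansion_order_ge cn0 hc hK').
Qed.

Lemma branch_index_bounds x : (1 <= branch_index f x <= d)%N.
Proof.
have [B [m [B0 hm hA]]] := lift_crossP x.
by rewrite (branch_index_lift B0 hA) //; case/andP: hm.
Qed.

Lemma ratdeg_gt0 : (0 < d)%N.
Proof. by have /andP[h1 h2] := branch_index_bounds None; exact: leq_trans h1 h2. Qed.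

Lemma deriv_lift_cross x :
  ((lift_cross x)^`().[chart x x] == 0) = (2 <= branch_index f x)%N.
Proof.
have [B [m [B0 hm hA]]] := lift_crossP x.
have m1 : (1 <= m)%N by case/andP: hm.
rewrite (branch_index_lift B0 hA m1) hA derivM hornerD !hornerM horner_exp hornerXsubC subrr.
rewrite expr0n (gtn_eqF m1) mulr0 add0r deriv_exp derivXsubC mul1r.
rewrite hornerMn horner_exp hornerXsubC subrr expr0n.
case: m m1 {hm hA} => [|[|m]] //= _; last by rewrite mul0rn mulr0 eqxx.
by rewrite mulr1n mulr1 (negPf B0).
Qed.

(** With [b'] and [q'] read as derivatives and [t' = 1], the right side is the Wronskian of
    [b * t^(m+1)] and [q]. *)
Lemma deriv_factor_identity (A : comNzRingType) (b b' q q' t : A) m :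
  ((b' * t + b *+ m.+1) * q - b * t * q') * t ^+ m =
  (b' * t ^+ m.+1 + b * (t ^+ m *+ m.+1)) * q - b * t ^+ m.+1 * q'.
Proof.
rewrite exprS -[b *+ _]mulr_natr -[t ^+ m *+ _]mulr_natr; move: (m.+1%:R) (t ^+ m) => c s; ring.
Qed.

(** The numerator of the derivative of [f]; its zeros are the finite critical points, multiple poles
    included. *)
Definition wronskian : {poly C} := P^`() * Q - P * Q^`().

Lemma horner_deriv_lift_cross_Some a : (lift_cross (Some a))^`().[a] = wronskian.[a].
Proof.
rewrite /lift_cross lift_num_Some lift_den_Some /= derivB !derivM !derivC !mulr0 !mul0r.
by rewrite !(addr0, add0r) /wronskian !hornerE /=.
Qed.

Lemma wronskian_neq0 : wronskian != 0.
Proof.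
have [a Qa] : exists a, Q.[a] != 0.
  have [e e0 he] := (nbhs_cabsP _ _).1 (near_neq_horner_neq0 0 (rden_neq0 f)).
  by have [a [a0 ae]] := exists_near_neq 0 e0; exists a; exact: he.
have [B [m [B0 hm hA]]] := lift_crossP (Some a).
move: hm hA B0; rewrite /lift_cross lift_num_Some lift_den_Some /=.
case: m => // m _ hA B0; apply/eqP => W0.
set A := _ - _ in hA.
(* Replacing [P] by [A] multiplies the Wronskian by the constant [Q(a)]. After division by a power
   of [X - a], its value at [a] is [(m+1) B(a) Q(a)], nonzero in characteristic 0. *)
have hW : A^`() * Q - A * Q^`() = (Q.[a])%:P * wronskian.
  rewrite /A /wronskian derivB !derivM !derivC; ring.
have : ((B^`() * ('X - a%:P) + B *+ m.+1) * Q - B * ('X - a%:P) * Q^`()) * ('X - a%:P) ^+ m = 0.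
  rewrite -[RHS](mulr0 (Q.[a])%:P) -W0 -hW hA derivM deriv_exp derivXsubC mul1r /=.
  exact: deriv_factor_identity.
move/eqP; rewrite mulf_eq0 expf_eq0 polyXsubC_eq0 andbF orbF => /eqP/(congr1 (horner^~ a)).
rewrite horner0 !(hornerXsubC, hornerD, hornerN, hornerM, hornerMn).
rewrite subrr !(mulr0, mul0r, add0r, subr0) => /eqP.
by rewrite mulf_eq0 (negPf Qa) orbF mulrn_eq0 (negPf B0).
Qed.

Lemma near_noncritical x : \forall y \near x, y != x -> branch_index f y = 1%N.
Proof.
have key a : wronskian.[a] != 0 -> branch_index f (Some a) = 1%N.
  move=> h; have := deriv_lift_cross (Some a).
  rewrite horner_deriv_lift_cross_Some (negPf h) => /esym/negbT.
  rewrite -ltnNge ltnS => h1; apply/eqP; rewrite eqn_leq h1 /=.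
  by case/andP: (branch_index_bounds (Some a)).
case: x => [a|].
  have := @one_point_compactification_some_nbhs C a _ (near_neq_horner_neq0 a wronskian_neq0).
  apply: filterS => _ [v hv <-] va; apply/key/hv.
  by apply: contra va => /eqP ->.
(* At infinity: some neighbourhood avoids the finitely many roots of the Wronskian. *)
have [rs hrs] := closed_field_poly_normal wronskian.
have : \forall y \near (None : S), forall r, r \in rs -> y != Some r.
  elim: rs {hrs} => [|r rs IH]; first by apply: filterS (near_chordal None ltr01) => y _ r.
  have h0 : 0 < chordal (None : S) (Some r) by rewrite /chordal divr_gt0 // sqrt1_gt0.
  apply: filterS2 IH (near_chordal None h0) => y h1 h2 s; rewrite inE => /orP[/eqP ->|].
    by apply: contraTneq h2 => ->; rewrite ltxx.
  exact: h1.
apply: filterS => -[v|] // hv _; apply: key.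
rewrite hrs hornerZ mulf_neq0 ?lead_coef_eq0 ?wronskian_neq0 // horner_prod.
rewrite prodf_seq_neq0; apply/allP => r rin /=.
by rewrite hornerXsubC subr_eq0; apply: contra (hv r rin) => /eqP ->.
Qed.

End RationalMaps.

(** * Openness, surjectivity, fibres and local injectivity *)

Section RationalMapsGlobal.
Variables (R : realType) (f : ratfun R).
Local Notation C := (Cplx R).
Local Notation S := (sphere R).
Implicit Types (x y z : S) (u v w : C).
Hypothesis hf : nonconstant f.

Lemma ratmap_open x (U : set S) : nbhs x U -> nbhs (f x) (f @` U).
Proof.
move=> Ux; set u0 := chart x x.
have [n [dn [s [dn0 s0 hn hrep hfw]]]] := local_quotient f x.
have A0 : n * (dn.[u0])%:P - (n.[u0])%:P * dn != 0.
  by rewrite hn scaler_eq0 negb_or s0 lift_cross_neq0.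
have : nbhs u0 (chart_inv x @^-1` U).
  by apply: continuous_chart_inv; rewrite chartK.
move=> /(filterI (near_horner_neq0 dn0))/nbhs_cabsP[rho rho0 hrho].
have [eta eta0 heta] := horner_quotient_open dn0 A0 rho0.
have [K K0 hK] := chart_lipschitz (f x).
have h0 : 0 < eta / K by rewrite divr_gt0.
apply: filterS2 hK (near_chordal (f x) h0) => y [yE hy] yx.
have w0 : chart (f x) (f x) = n.[u0] / dn.[u0].
  by rewrite -hrep // /local_rep chartK.
have [|v vu hv] := heta (chart (f x) y).
  by rewrite -w0; apply: le_lt_trans hy _; rewrite mulrC -ltr_pdivlMr.
have [dv Uv] := hrho v vu.
by exists (chart_inv x v) => //; rewrite (hfw _ _ dv hv).
Qed.

Lemma ratmap_surj y : exists x, f x = y.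
Proof.
have [r [s [rs ->]]] := pt_surj y.
pose E := s *: rnum f - r *: rden f.
have pE a : E.[a] = (lift_num f (Some a)).[a] * s - (lift_den f (Some a)).[a] * r.
  by rewrite lift_num_Some lift_den_Some /E !hornerE [s * _]mulrC [r * _]mulrC.
have [E1|] := boolP (size E == 1%N); last first.
  move=> /closed_rootP[a /rootP Ea]; exists (Some a).
  rewrite (ratmap_lift f (Some a) a); apply/pt_eqP; rewrite ?lift_neq0 //.
  by apply/eqP; rewrite -subr_eq0 -pE Ea.
(* Here [E] is a nonzero constant, so its coefficient of degree [d > 0] vanishes; this says that
   infinity is a preimage. *)
exists None; rewrite (_ : None = pt 1 0 :> S); last by rewrite /pt eqxx.
have h10 : ((1 : C) != 0) || ((0 : C) != 0) by rewrite oner_eq0.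
rewrite ratmap_pt // !homogx0 expr1n !mulr1; apply/pt_eqP => //.
  by have := homog_ratfun_neq0 f h10; rewrite !homogx0 expr1n !mulr1.
have : E`_(ratdeg f) = 0.
  by apply: nth_default; rewrite (eqP E1); exact: ratdeg_gt0.
rewrite /E coefB !coefZ => /eqP; rewrite subr_eq0 => /eqP h.
by rewrite mulrC h mulrC.
Qed.

(** The size is bounded uniformly in [y] because it enters the norm estimates of the bimodule. The
    extra place is for infinity. *)
Lemma ratmap_fiber y : exists2 s : seq S, (size s <= (ratdeg f).+1)%N &
  forall x, f x = y -> x \in s.
Proof.
have [r [t [rs ->]]] := pt_surj y.
pose E := t *: rnum f - r *: rden f.
have pE a : f (Some a) = pt r t <-> E.[a] = 0.
  rewrite (ratmap_lift f (Some a) a); apply: iff_trans (pt_eqP (lift_neq0 _ _ _) rs) _.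
  rewrite lift_num_Some lift_den_Some /E !hornerE; split => [h|/eqP].
    by rewrite [t * _]mulrC h mulrC subrr.
  by rewrite subr_eq0 => /eqP h; rewrite mulrC h mulrC.
have E0 : E != 0.
  apply/eqP => E0; have /eqP[] := lift_cross_neq0 hf (Some 0).
  have A0 v : (lift_cross f (Some 0)).[v] = 0.
    have h1 : f (Some v) = pt r t by apply/pE; rewrite E0 horner0.
    have h2 : f (Some 0) = pt r t by apply/pE; rewrite E0 horner0.
    move: h1; rewrite -h2 (ratmap_lift f (Some v) v) (ratmap_lift f (Some 0) 0).
    move/pt_eqP => h; rewrite lift_crossE /=.
    rewrite !lift_num_Some !lift_den_Some in h *.
    rewrite h; [by rewrite mulrC subrr| |].
      by have := lift_neq0 f (Some v) v; rewrite lift_num_Some lift_den_Some.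
    by have := lift_neq0 f (Some 0) 0; rewrite lift_num_Some lift_den_Some.
  apply: contrapT => /eqP A1.
  have [e e0 he] := (nbhs_cabsP _ _).1 (near_neq_horner_neq0 0 A1).
  by have [v [v0 ve]] := exists_near_neq 0 e0; have := he v ve v0; rewrite A0 eqxx.
have [rs' hrs] := closed_field_poly_normal E.
exists (None :: map Some rs').
  rewrite /= size_map; have : size E = (size rs').+1.
    by rewrite hrs size_scale ?lead_coef_eq0 // size_prod_XsubC.
  have : (size E <= (ratdeg f).+1)%N.
    rewrite /E; apply: leq_trans (size_polyD _ _) _; rewrite size_polyN geq_max.
    by rewrite !(leq_trans (size_scale_leq _ _)) ?size_rnum_le ?size_rden_le.
  by move=> h1 h2; rewrite -h2.
move=> [a /pE/eqP|_]; last by rewrite inE.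
rewrite inE /= mem_map; last by move=> ? ? [].
rewrite hrs hornerZ mulf_eq0 lead_coef_eq0 (negPf E0) /= -/(root _ _) root_prod_XsubC.
by [].
Qed.

Lemma ratmap_local_inj x : branch_index f x = 1%N ->
  exists2 U : set S, nbhs x U & forall y z, U y -> U z -> f y = f z -> y = z.
Proof.
move=> e1; set u0 := chart x x.
set p := lift_num f x; set q := lift_den f x.
(* [G(u0)] is the derivative of [lift_cross] at [u0]. If [f] agrees at [u] and [v], then
   [(u - v) G(v)] combines two errors of strict differentiability and is at most
   [|G(u0)| / 4 * |u - v|], while [|G(v)| >= |G(u0)| / 2]. *)
pose G := p^`().[u0] *: q - q^`().[u0] *: p.
have G0 : G.[u0] != 0.
  have := deriv_lift_cross hf x; rewrite e1 /= => /negbT.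
  rewrite /lift_cross -/u0 -/p -/q derivB !derivM !derivC !mulr0 !mul0r !(addr0, add0r).
  by rewrite /G !hornerE /= [p.[u0] * _]mulrC.
have g0 : 0 < cabs G.[u0] by rewrite cabs_gt0.
pose M := cabs p.[u0] + cabs q.[u0] + 2.
have M0 : 0 < M by rewrite ltr_wpDl // addr_ge0 ?cabs_ge0.
have e0 : 0 < cabs G.[u0] / (4 * M) by rewrite divr_gt0 // mulr_gt0.
have [d1 d10 h1] := horner_strict_diff p u0 e0.
have [d2 d20 h2] := horner_strict_diff q u0 e0.
have [d3 d30 h3] := (nbhs_cabsP _ _).1 (filterI (near_horner_ge G0)
  (filterI (near_horner_le p u0) (near_horner_le q u0))).
pose dl := Num.min (Num.min d1 d2) d3.
have dl0 : 0 < dl by rewrite !lt_min d10 d20 d30.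
exists (chart_inv x @` [set u | cabs (u - u0) < dl]).
  have : \forall u \near u0, (chart_inv x @` [set u | cabs (u - u0) < dl]) (chart_inv x u).
    by apply: filterS (near_cabs u0 dl0) => u hu; exists u.
  exact: near_chart.
move=> _ _ [u hu <-] [v hv <-]; move: hu hv; rewrite /= /dl !lt_min.
move=> /andP[/andP[u1 u2] u3] /andP[/andP[v1 v2] v3]; rewrite !ratmap_lift => /pt_eqP h; congr chart_inv.
have {}h : p.[u] * q.[v] = q.[u] * p.[v] by apply: h; exact: lift_neq0.
apply/eqP; rewrite -subr_eq0 -cabs_eq0 eq_le cabs_ge0 andbT leNgt; apply/negP => uv.
have k1 := h1 _ _ u1 v1; have k2 := h2 _ _ u2 v2.
have [k3 [k4 k5]] := h3 v v3.
have : cabs ((u - v) * G.[v]) <= cabs G.[u0] / (4 * M) * cabs (u - v) * (cabs q.[v] + cabs p.[v]).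
  have -> : (u - v) * G.[v] = (q.[u] - q.[v] - (u - v) * q^`().[u0]) * p.[v]
     - (p.[u] - p.[v] - (u - v) * p^`().[u0]) * q.[v].
    transitivity ((u - v) * G.[v] - (p.[u] * q.[v] - q.[u] * p.[v])); last by rewrite /G !hornerE; ring.
    by rewrite h subrr subr0.
  apply: le_trans (cabs_triangleB _ _) _; rewrite !cabsM.
  have := cabs_ge0 p.[v]; have := cabs_ge0 q.[v]; nra.
have -> : cabs G.[u0] / (4 * M) * cabs (u - v) * (cabs q.[v] + cabs p.[v]) =
  cabs (u - v) * (cabs G.[u0] / 4 * ((cabs q.[v] + cabs p.[v]) / M)) by field; rewrite gt_eqF.
rewrite cabsM ler_pM2l //; have : (cabs q.[v] + cabs p.[v]) / M <= 1.
  by rewrite ler_pdivrMr // mul1r /M; lra.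
nra.
Qed.

(** Exponent at least 1 everywhere makes the iterates Lipschitz at each point; exponent at least 2
    at critical points makes a critical cycle attracting. *)
Lemma ratmap_holder x : exists2 K : R, 0 < K &
  \forall y \near x, chordal (f x) (f y) <= K * chordal x y ^+ branch_index f x.
Proof.
set u0 := chart x x.
have [B [m [B0 /andP[m1 _] hA]]] := lift_crossP hf x.
rewrite (branch_index_lift B0 hA m1); rewrite -/u0 in B0 hA.
have [K K0 hK] := chordal_pt_le (lift_neq0 f x u0).
have [L L0 hL] := chart_lipschitz x.
pose b := cabs B.[u0] + 1; have b0 : 0 < b by rewrite ltr_wpDl ?cabs_ge0.
exists (K * b * L ^+ m); first by rewrite !mulr_gt0 // exprn_gt0.
have : \forall u \near u0, chordal (f x) (f (chart_inv x u)) <= K * b * cabs (u - u0) ^+ m.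
  apply: filterS2 hK (near_horner_le B u0) => u [_ hu] hB.
  rewrite -{1}(chartK x) !ratmap_lift; apply: le_trans hu _.
  rewrite -lift_crossE hA hornerM horner_exp hornerXsubC cabsM cabsX mulrA.
  by rewrite ler_wpM2r ?exprn_ge0 ?cabs_ge0 // ler_pM2l.
have hL' : \forall y \near x, cabs (chart x y - u0) <= L * chordal x y.
  by apply: filterS hL => y [].
have hL2 : \forall y \near x, chart_inv x (chart x y) = y.
  by apply: filterS hL => y [].
move=> /nbhs_cabsP[e e0 he].
have eL : 0 < e / L by rewrite divr_gt0.
apply: filterS3 hL' hL2 (near_chordal x eL) => y h1 h2 h3.
have hyu : cabs (chart x y - u0) < e.
  by apply: le_lt_trans h1 _; rewrite mulrC -ltr_pdivlMr.
have := he _ hyu; rewrite /= h2 => /le_trans; apply.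
rewrite -[K * b * L ^+ m * _]mulrA -exprMn ler_pM2l ?mulr_gt0 //.
by apply: lerXn2r; rewrite ?nnegrE ?cabs_ge0 // mulr_ge0 ?chordal_ge0 ?(ltW L0).
Qed.

End RationalMapsGlobal.

(** * The Fatou set *)

Section FatouSet.
Variables (R : realType) (f : ratfun R).
Local Notation C := (Cplx R).
Local Notation S := (sphere R).
Implicit Types (x y z : S) (u v w : C).
Hypothesis hf : nonconstant f.

Definition equicontinuous_at x := forall eps : R, 0 < eps ->
  \forall y \near x, forall n, chordal (iter n f x) (iter n f y) < eps.

Lemma fatouP x : Defs.fatou f x <-> \forall y \near x, equicontinuous_at y.
Proof.
split=> [[U [oU eU] Ux]|].
  by apply: filterS (open_nbhs_nbhs (conj oU Ux)) => y /eU.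
rewrite /prop_near1 nbhsE => -[U [oU Ux] UE]; by exists U.
Qed.

Lemma fatou_open : open (Defs.fatou f).
Proof. by apply: bigcup_open => U []. Qed.

Lemma equicontinuous_at_image x : equicontinuous_at x -> equicontinuous_at (f x).
Proof.
move=> ex eps /ex/(ratmap_open hf); apply: filterS => _ [z hz <-] n.
by rewrite -!iterSr.
Qed.

Lemma equicontinuous_at_preimage x : equicontinuous_at (f x) -> equicontinuous_at x.
Proof.
move=> ex eps eps0; have := @ratmap_continuous R f x _ (ex eps eps0).
apply: filterS2 (near_chordal x eps0) => z h0 h [|n] //.
by rewrite !iterSr.
Qed.

Lemma fatou_image x : Defs.fatou f x <-> Defs.fatou f (f x).
Proof.
split=> /fatouP h; apply/fatouP.
  have h' : nbhs x equicontinuous_at := h.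
  by apply: filterS (ratmap_open hf h') => _ [z hz <-]; exact: equicontinuous_at_image.
have h' : nbhs (f x) equicontinuous_at := h.
have : \forall z \near x, equicontinuous_at (f z) := @ratmap_continuous R f x _ h'.
by apply: filterS => z; exact: equicontinuous_at_preimage.
Qed.

Lemma julia_image x : julia f x <-> julia f (f x).
Proof. by rewrite /julia /setC /= fatou_image. Qed.

Lemma julia_iter n x : julia f x <-> julia f (iter n f x).
Proof.
elim: n => [|n IH] //; rewrite iterS; exact: iff_trans IH (julia_image _).
Qed.

Lemma iter_lipschitz_at n x : exists2 K : R, 0 < K &
  \forall y \near x, chordal (iter n f x) (iter n f y) <= K * chordal x y.
Proof.
elim: n x => [|n IH] x.
  by exists 1 => //; apply: filterS (near_chordal x ltr01) => y _; rewrite mul1r.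
have [K K0 hK] := IH (f x); have [L L0 hL] := ratmap_holder hf x.
exists (K * L); first by rewrite mulr_gt0.
have hK' : \forall y \near x, chordal (iter n f (f x)) (iter n f (f y)) <= K * chordal (f x) (f y).
  exact: @ratmap_continuous R f x _ hK.
apply: filterS3 hK' hL (near_chordal x ltr01) => y h1 h2 h3.
rewrite !iterSr; apply: le_trans h1 _; rewrite -mulrA ler_pM2l //.
apply: le_trans h2 _; rewrite ler_pM2l // -[leRHS]expr1.
apply: ler_wiXn2l; rewrite ?chordal_ge0 ?(ltW h3) //.
by case/andP: (branch_index_bounds hf x).
Qed.

Lemma near_iter_chordal x (eps : R) N : 0 < eps ->
  \forall y \near x, forall n, (n < N)%N -> chordal (iter n f x) (iter n f y) < eps.
Proof.
move=> eps0; elim: N => [|N IH]; first by apply: filterS (near_chordal x eps0) => y _ n.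
have /continuous_chordalP/(_ _ eps0) := @iter_ratmap_continuous R f N x.
apply: filterS2 IH => y h1 h2 n; rewrite ltnS leq_eqVlt => /orP[/eqP ->//|]; exact: h1.
Qed.

(** By the quadratic bound at the critical point, the return map at least halves the distance to [x]
    on a small ball. *)
Lemma superattracting_fatou x m : critical f x -> (0 < m)%N -> iter m f x = x -> Defs.fatou f x.
Proof.
rewrite /critical /=; case: m => // m crit _ per.
have [K K0 hK] := iter_lipschitz_at m (f x); have [L L0 hL] := ratmap_holder hf x.
pose r0 := 2^-1 / (K * L); have r00 : 0 < r0 by rewrite divr_gt0 ?invr_gt0 ?mulr_gt0.
have : \forall y \near x, chordal x (iter m.+1 f y) <= chordal x y / 2.
  have h4 : \forall y \near x, chordal x y < 1 /\ chordal x y < r0.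
    exact: filterI (near_chordal x ltr01) (near_chordal x r00).
  have hK' : \forall y \near x, chordal (iter m f (f x)) (iter m f (f y)) <= K * chordal (f x) (f y).
    exact: @ratmap_continuous R f x _ hK.
  apply: filterS3 hK' hL h4 => y h1 h2 [h3 h4'].
  rewrite -{1}per !iterSr; apply: le_trans h1 _.
  have c0 := chordal_ge0 x y.
  have h5 : chordal x y ^+ branch_index f x <= chordal x y ^+ 2.
    by apply: ler_wiXn2l; rewrite // ltW.
  have h6 : K * chordal (f x) (f y) <= K * (L * chordal x y ^+ 2).
    by rewrite ler_pM2l //; apply: le_trans h2 _; rewrite ler_pM2l.
  apply: le_trans h6 _.
  move: h4'; rewrite /r0 ltr_pdivlMr ?mulr_gt0 // expr2 => h4.
  have -> : K * (L * (chordal x y * chordal x y)) = chordal x y * (chordal x y * (K * L)) by ring.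
  by rewrite ler_wpM2l // ltW.
move=> /nbhs_chordalP[r rr hr].
have contr k y : chordal x y < r -> chordal x (iter (k * m.+1) f y) <= chordal x y / 2 ^+ k.
  move=> yr; elim: k => [|k IH]; first by rewrite mul0n expr0 divr1.
  rewrite mulSn iterD; apply: le_trans (hr _ _) _.
    apply: le_lt_trans IH _; apply: le_lt_trans yr.
    by rewrite ler_pdivrMr ?exprn_gt0 // ler_peMr ?chordal_ge0 // exprn_ege1 // ler1n.
  by rewrite exprSr invfM mulrA ler_pM2r ?invr_gt0.
have perk k : iter (k * m.+1) f x = x.
  by elim: k => // k IH; rewrite mulSn iterD IH.
have unif eps : 0 < eps -> exists2 s : R, 0 < s & forall y, chordal x y < s ->
    forall n, chordal (iter n f x) (iter n f y) < eps.
  move=> eps0; have /nbhs_chordalP[s s0 hs] := near_iter_chordal x m.+1 eps0.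
  exists (Num.min s r) => [|y]; first by rewrite lt_min s0.
  rewrite lt_min => /andP[ys yr] n.
  rewrite (divn_eq n m.+1) addnC !iterD perk; apply: hs; last by rewrite ltn_mod.
  apply: le_lt_trans (contr _ _ yr) _; apply: le_lt_trans ys.
  by rewrite ler_pdivrMr ?exprn_gt0 // ler_peMr ?chordal_ge0 // exprn_ege1 // ler1n.
(* The Fatou set asks for equicontinuity at every [y] near [x]. After [k] periods [y] and its
   neighbours lie within [s] of [x], where [unif] applies; the finitely many earlier iterates are
   continuous. *)
apply/fatouP; apply: filterS (near_chordal x rr) => y yr eps eps0.
have eps2 : 0 < eps / 2 by lra.
have [s s0 hs] := unif _ eps2.
have [k hk] : exists k, chordal x (iter (k * m.+1) f y) < s.
  exists (Num.truncn (r / s)).+1; apply: le_lt_trans (contr _ y yr) _.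
  set k := (Num.truncn (r / s)).+1; rewrite ltr_pdivrMr ?exprn_gt0 //.
  have h1 : r / s < k%:R by exact: truncnS_gt.
  have h2 : k%:R <= 2 ^+ k :> R by rewrite -natrX ler_nat ltnW // ltn_expl.
  move: h1; rewrite ltr_pdivrMr // => h1; apply: lt_trans yr _; apply: lt_le_trans h1 _.
  by rewrite mulrC ler_pM2l.
have hc : \forall z \near y, chordal x (iter (k * m.+1) f z) < s.
  have d0 : 0 < s - chordal x (iter (k * m.+1) f y) by lra.
  have /continuous_chordalP/(_ _ d0) := @iter_ratmap_continuous R f (k * m.+1)%N y.
  apply: filterS => z; have := chordal_triangle (iter (k * m.+1) f y) x (iter (k * m.+1) f z).
  lra.
apply: filterS2 hc (near_iter_chordal y (k * m.+1) eps0) => z h1 h2 n.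
have [/h2//|nk] := ltnP n (k * m.+1).
rewrite -(subnK nk) !iterD.
have := hs _ hk (n - k * m.+1)%N; have := hs _ h1 (n - k * m.+1)%N.
have := chordal_triangle (iter (n - k * m.+1) f x) (iter (n - k * m.+1) f (iter (k * m.+1) f y))
   (iter (n - k * m.+1) f (iter (k * m.+1) f z)).
rewrite [chordal (iter _ f (iter _ f y)) (iter _ f x)]chordalC.
lra.
Qed.

End FatouSet.

(** * Maximum principle and Hurwitz' theorem *)

Section RationalOnDisc.
Variable R : realType.
Local Notation C := (Cplx R).
Implicit Types (c u v : C) (r M : R) (h g : C -> C).

Definition disc c r : set C := [set u | cabs (u - c) <= r].

Definition rational_on (D : set C) h := exists p q : {poly C},
  forall u, D u -> q.[u] != 0 /\ h u = p.[u] / q.[u].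

Lemma rational_on_sub D D' h : D' `<=` D -> rational_on D h -> rational_on D' h.
Proof. by move=> DD [p [q hpq]]; exists p, q => u /DD/hpq. Qed.

Lemma rational_onV D h : (forall u, D u -> h u != 0) -> rational_on D h ->
  rational_on D (fun u => (h u)^-1).
Proof.
move=> h0 [p [q hpq]]; exists q, p => u Du; have [q0 hE] := hpq u Du.
have := h0 u Du; rewrite hE mulf_eq0 negb_or => /andP[p0 _].
by rewrite invf_div.
Qed.

Lemma continuous_quotient (p q : {poly C}) u : q.[u] != 0 ->
  {for u, continuous (fun v => p.[v] / q.[v])}.
Proof.
move=> q0; apply/continuous_cabsP => e e0.
have c0 : 0 < cabs q.[u] by rewrite cabs_gt0.
pose d := e * (cabs q.[u] ^+ 2 / 2).
have h0 : 0 < d by rewrite mulr_gt0 // divr_gt0 // exprn_gt0.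
have := near_horner (p * (q.[u])%:P - (p.[u])%:P * q) u h0.
apply: filterS2 (near_horner_ge q0) => v qv; rewrite !hornerE subrr subr0 => hv.
have qv0 : q.[v] != 0 by rewrite -cabs_gt0; lra.
have -> : p.[v] / q.[v] - p.[u] / q.[u] =
   (p.[v] * q.[u] - p.[u] * q.[v]) / (q.[v] * q.[u]) by field; rewrite q0 qv0.
rewrite cabs_div ltr_pdivrMr; last by rewrite cabs_gt0 mulf_neq0.
by apply: lt_le_trans hv _; rewrite /d cabsM ler_pM2l //; nra.
Qed.

Lemma disc_center c r : 0 <= r -> disc c r c.
Proof. by rewrite /disc /= subrr cabs0. Qed.

Lemma max_principle c r h M : 0 < r -> rational_on (disc c r) h ->
  (forall u, cabs (u - c) = r -> cabs (h u) <= M) ->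
  forall u, disc c r u -> cabs (h u) <= M.
Proof.
move=> r0 [p [q hpq]] hM u1 Du1; rewrite leNgt; apply/negP => h1.
have cr : cabs (c + rc r - c) = r by rewrite addrAC subrr add0r cabs_rc_ge0 ?ltW.
have M0 : 0 <= M := le_trans (cabs_ge0 _) (hM _ cr).
have [u0 /set_mem D0 hmax] : exists2 u0, u0 \in disc c r &
    forall t, t \in disc c r -> cabs (p.[t] / q.[t]) <= cabs (p.[u0] / q.[u0]).
  apply: compact_EVT_max; [by exists u1|exact: compact_disc|].
  apply: continuous_in_subspaceT => u /set_mem Du; have [q0 _] := hpq u Du.
  apply: (@continuous_comp _ _ _ (fun u => p.[u] / q.[u]) (@cabs R)); last exact: continuous_cabs.
  exact: continuous_quotient.
have [q0 hE0] := hpq u0 D0.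
pose s := cabs (p.[u0] / q.[u0]).
have Ms : M < s.
  apply: lt_le_trans h1 _; have [_ ->] := hpq u1 Du1; apply: hmax; exact/mem_set.
have u0r : cabs (u0 - c) < r.
  rewrite lt_neqAle D0 andbT; apply/negP => /eqP/hM; rewrite hE0 leNgt.
  by rewrite -/s Ms.
have [A0|A0] := eqVneq (p * (q.[u0])%:P - (p.[u0])%:P * q) 0.
  have Dr : disc c r (c + rc r) by rewrite /disc /= cr.
  have [qr hEr] := hpq _ Dr; have := hM _ cr; rewrite leNgt => /negP; apply.
  rewrite hEr; suff -> : p.[c + rc r] / q.[c + rc r] = p.[u0] / q.[u0] by [].
  apply/eqP; rewrite eqr_div //; apply/eqP.
  have := congr1 (horner^~ (c + rc r)) A0; rewrite !hornerE => /eqP.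
  by rewrite subr_eq0 => /eqP.
have rho0 : 0 < r - cabs (u0 - c) by lra.
have [eta eta0 heta] := horner_quotient_open q0 A0 rho0.
have s0 : 0 < s by lra.
pose t := eta / s / 2; have t0 : 0 < t by rewrite !divr_gt0.
have [|v vu hv] := heta (p.[u0] / q.[u0] * (1 + rc t)).
  rewrite mulrDr mulr1 addrAC subrr add0r cabsM -/s cabs_rc_ge0 ?ltW // /t.
  rewrite (_ : s * _ = eta / 2); first by lra.
  by field; rewrite gt_eqF.
have Dv : disc c r v.
  rewrite /disc /=; have := cabs_triangle (v - u0) (u0 - c); rewrite addrA subrK; lra.
have [qv _] := hpq v Dv; have := hmax v (mem_set Dv).
rewrite hv mulfK // cabsM -/s.
have -> : 1 + rc t = rc (1 + t) by rewrite rcD.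
rewrite cabs_rc_ge0; last by rewrite addr_ge0 // ltW.
by rewrite mulrDr mulr1 gerDl leNgt mulr_gt0.
Qed.

Lemma min_principle c r h M : 0 < r -> rational_on (disc c r) h ->
  (forall u, disc c r u -> h u != 0) ->
  (forall u, cabs (u - c) = r -> M <= cabs (h u)) -> M <= cabs (h c).
Proof.
move=> r0 hr h0 hM; have [M0|M0] := lerP M 0; first exact: le_trans M0 (cabs_ge0 _).
have Dc : disc c r c by apply: disc_center; exact: ltW.
have := max_principle (M := M^-1) r0 (rational_onV h0 hr) _ Dc.
rewrite cabsV lef_pV2 ?posrE ?cabs_gt0 ?h0 //; apply=> u hu.
have Du : disc c r u by rewrite /disc /= hu.
by rewrite cabsV lef_pV2 ?posrE ?cabs_gt0 ?h0 // hM.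
Qed.

(** The factor [u - c] divides the numerator of [h - h c], so [k] is again a quotient of
    polynomials. On the boundary [|u - c| = r], and the maximum principle carries the bound
    inside. *)
Lemma difference_quotient c r h M : 0 < r -> rational_on (disc c r) h ->
  (forall u, disc c r u -> cabs (h u) <= M) ->
  exists k, [/\ rational_on (disc c r) k,
    (forall u, disc c r u -> cabs (k u) <= 2 * M / r) &
    (forall u, disc c r u -> h u = h c + (u - c) * k u)].
Proof.
move=> r0 [p [q hpq]] hM; have Dc : disc c r c by apply: disc_center; exact: ltW.
have [qc hc] := hpq c Dc.
have /factor_theorem[g hg] : root (p * (q.[c])%:P - (p.[c])%:P * q) c.
  by rewrite /root !hornerE mulrC subrr.
pose k u := g.[u] / ((q.[c])%:P * q).[u].
have kr : rational_on (disc c r) k.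
  by exists g, ((q.[c])%:P * q) => u /hpq[qu _]; split=> //; rewrite hornerM hornerC mulf_neq0.
have hE u : disc c r u -> h u = h c + (u - c) * k u.
  move=> /hpq[qu ->]; rewrite hc /k hornerM hornerC.
  have e := congr1 (horner^~ u) hg; rewrite !hornerE in e.
  have -> : (u - c) * (g.[u] / (q.[c] * q.[u])) = (g.[u] * (u - c)) / (q.[c] * q.[u]) by ring.
  by rewrite -e; field; rewrite qc qu.
exists k; split=> //; apply: max_principle => // u ur.
have Du : disc c r u by rewrite /disc /= ur.
rewrite ler_pdivlMr // mulrC -ur -cabsM.
have -> : (u - c) * k u = h u - h c by rewrite (hE u Du) addrAC subrr add0r.
by apply: le_trans (cabs_triangleB _ _) _; have := hM _ Du; have := hM _ Dc; lra.
Qed.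

Lemma rational_lipschitz c r h M : 0 < r -> rational_on (disc c r) h ->
  (forall u, disc c r u -> cabs (h u) <= M) ->
  forall u, disc c r u -> cabs (h u - h c) <= 2 * M / r * cabs (u - c).
Proof.
move=> r0 hr hM u Du; have [k [_ kM hE]] := difference_quotient r0 hr hM.
rewrite hE // addrAC subrr add0r cabsM mulrC ler_wpM2r ?cabs_ge0 //.
exact: kM.
Qed.

(* By induction on [k] the first [k] Taylor coefficients of [h] are small: otherwise
   the first large one would dominate on a small circle and bound [h 0] from below by
   the minimum principle.  The radius 2 makes the bound 1 stable under
   [difference_quotient]. *)
Lemma hurwitz_taylor (k : nat) (e : R) : 0 < e -> exists2 eta : R, 0 < eta &
  forall h, rational_on (disc 0 2) h -> (forall u, disc 0 2 u -> h u != 0) ->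
    (forall u, disc 0 2 u -> cabs (h u) <= 1) -> cabs (h 0) < eta ->
  exists g, [/\ rational_on (disc 0 2) g, (forall u, disc 0 2 u -> cabs (g u) <= 1) &
    forall u, disc 0 2 u -> cabs (h u - u ^+ k * g u) <= e].
Proof.
elim: k e => [|k IH] e e0.
  exists 1 => // h hr _ h1 _; exists h; split=> // u _.
  by rewrite expr0 mul1r subrr cabs0 ltW.
have t0 : 0 < 2 ^+ k :> R by rewrite exprn_gt0.
set t := (2 ^+ k : R) in t0.
(* The constants make [|h 0|], [e'] and [rho^(k+1)] add up to at most [rho^k * e / (2 t)]. Hence
   [t * |g 0| <= e / 2], where [t = 2^k] bounds [|u|^k] on the disc. *)
pose rho := Num.min 1 (e / (4 * t)).
have rho0 : 0 < rho by rewrite lt_min ltr01 divr_gt0 // mulr_gt0.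
have rho1 : rho <= 1 by rewrite ge_min lexx.
have rhoe : rho * (4 * t) <= e.
  have : rho <= e / (4 * t) by rewrite ge_min lexx orbT.
  by rewrite ler_pdivlMr // mulr_gt0.
have rk0 : 0 < rho ^+ k by rewrite exprn_gt0.
pose e1 := rho ^+ k * e / (8 * t).
have e10 : 0 < e1 by rewrite divr_gt0 ?mulr_gt0.
pose e' := Num.min (e / 2) e1.
have e'0 : 0 < e' by rewrite lt_min divr_gt0.
have e'e : e' <= e / 2 by rewrite ge_min lexx.
have e'e1 : e' <= e1 by rewrite ge_min lexx orbT.
have [eta eta0 heta] := IH e' e'0.
exists (Num.min eta e1) => [|h hr h0 h1]; first by rewrite lt_min eta0.
rewrite lt_min => /andP[hc hc1].
have [g [gr g1 gE]] := heta h hr h0 h1 hc.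
have two0 : 0 < 2 :> R by [].
have [g' [gr' g1' gE']] := difference_quotient two0 gr g1.
have g1'' u : disc 0 2 u -> cabs (g' u) <= 1.
  by move=> /g1'; rewrite mulr1 divff.
exists g'; split=> // u Du.
have D02 u' : cabs u' <= 2 -> disc 0 2 u' by rewrite /disc /= subr0.
have small : cabs (g 0) * rho ^+ k <= cabs (h 0) + e' + rho ^+ k.+1.
  suff : cabs (g 0) * rho ^+ k - e' - rho ^+ k.+1 <= cabs (h 0) by lra.
  apply: (@min_principle 0 rho) => //.
  - apply: rational_on_sub hr => v; rewrite /disc /=; lra.
  - by move=> v Dv; apply: h0; move: Dv; rewrite /disc /=; lra.
  move=> v; rewrite subr0 => vr; have Dv : disc 0 2 v by apply: D02; lra.
  have k1 := gE v Dv; have k2 := gE' v Dv.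
  rewrite subr0 in k2.
  have -> : cabs (g 0) * rho ^+ k = cabs ((v ^+ k * g v - v ^+ k.+1 * g' v)).
    rewrite -vr -cabsX -cabsM k2 exprS; congr cabs; ring.
  have k3 := cabs_lower (v ^+ k * g v - v ^+ k.+1 * g' v) (- (v ^+ k.+1 * g' v)).
  rewrite opprK subrK cabsN in k3.
  have k4 : cabs (v ^+ k.+1 * g' v) <= rho ^+ k.+1.
    by rewrite cabsM cabsX vr ler_piMr ?exprn_ge0 ?g1'' // ltW.
  have k5 := cabs_lower (v ^+ k * g v) (h v).
  rewrite (cabs_distC (v ^+ k * g v)) in k5.
  lra.
have small2 : cabs (g 0) * t <= e / 2.
  have : cabs (g 0) * rho ^+ k <= rho ^+ k * (e / (2 * t)).
    apply: le_trans small _; rewrite exprSr.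
    have h4 : rho <= e / (4 * t) by rewrite ge_min lexx orbT.
    have h5 : rho ^+ k * rho <= rho ^+ k * (e / (4 * t)) by rewrite ler_pM2l.
    have h6 : rho ^+ k * (e / (2 * t)) = e1 + e1 + rho ^+ k * (e / (4 * t)).
      by rewrite /e1; field; rewrite gt_eqF.
    lra.
  rewrite mulrC ler_pM2l // ler_pdivlMr ?mulr_gt0 // => h2.
  lra.
rewrite (_ : h u - _ = (h u - u ^+ k * g u) + u ^+ k * g 0); last first.
  by rewrite (gE' u Du) subr0 exprS; ring.
apply: le_trans (cabs_triangle _ _) _; rewrite [cabs (_ * g 0)]cabsM cabsX.
have h3 : cabs u ^+ k <= t.
  by apply: lerXn2r; rewrite ?nnegrE ?cabs_ge0 //; move: Du; rewrite /disc /= subr0.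
have := gE u Du; have : cabs u ^+ k * cabs (g 0) <= t * cabs (g 0) by rewrite ler_wpM2r ?cabs_ge0.
lra.
Qed.

(* [eta] depends neither on [h] nor on the disc: this uniformity replaces the
   passage to the limit in Hurwitz' theorem. *)
Lemma hurwitz (e : R) : 0 < e -> exists2 eta : R, 0 < eta &
  forall c r h, 0 < r -> rational_on (disc c r) h -> (forall u, disc c r u -> h u != 0) ->
    (forall u, disc c r u -> cabs (h u) <= 1) -> cabs (h c) < eta ->
  forall u, disc c (r / 4) u -> cabs (h u) < e.
Proof.
move=> e0; have e30 : 0 < e / 3 by lra.
pose k := (Num.truncn (3 / e)).+1.
have hk : (2^-1 : R) ^+ k < e / 3.
  have h1 : 3 / e < k%:R by exact: truncnS_gt.
  have h2 : k%:R <= 2 ^+ k :> R by rewrite -natrX ler_nat ltnW // ltn_expl.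
  rewrite exprVn -[e / 3]invrK ltf_pV2 ?posrE ?exprn_gt0 ?invr_gt0 //.
  by rewrite invf_div; apply: lt_le_trans h1 h2.
have [eta eta0 heta] := hurwitz_taylor k e30.
exists eta => // c r h r0 [p [q hpq]] h0 h1 hc u Du.
(* The affine map [l] carries the disc of radius 2 around 0 to the given disc. The quarter disc
   corresponds to [|v| <= 1/2], where [|v|^k <= 2^-k < e / 3]. *)
pose l : {poly C} := rc (r / 2) *: 'X + c%:P.
have lE v : l.[v] = rc (r / 2) * v + c by rewrite /l !hornerE.
have r20 : 0 < r / 2 by lra.
have lD v : disc 0 2 v -> disc c r l.[v].
  rewrite /disc /= subr0 lE addrK cabsM cabs_rc_ge0 ?(ltW r20) // => v2.
  have := cabs_ge0 v; nra.
have [|||| g [_ g1 gE]] := heta (fun v => h l.[v]).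
- exists (p \Po l), (q \Po l) => v /lD/hpq; by rewrite !horner_comp.
- by move=> v /lD/h0.
- by move=> v /lD/h1.
- by rewrite lE mulr0 add0r.
pose v := (u - c) / rc (r / 2).
have rc0 : rc (r / 2) != 0 :> C by rewrite -cabs_gt0 cabs_rc_ge0 // ltW.
have lv : l.[v] = u by rewrite lE /v mulrC divfK // subrK.
have v2 : cabs v <= 2^-1.
  rewrite /v cabs_div cabs_rc_ge0 ?(ltW r20) // ler_pdivrMr //.
  move: Du; rewrite /disc /=; lra.
have Dv : disc 0 2 v by rewrite /disc /= subr0; lra.
have := gE v Dv; rewrite lv => k1.
have k2 : cabs (v ^+ k * g v) <= 2^-1 ^+ k.
  rewrite cabsM cabsX; apply: le_trans (_ : 2^-1 ^+ k * 1 <= _); last by rewrite mulr1.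
  apply: ler_pM; rewrite ?exprn_ge0 ?cabs_ge0 ?g1 //.
  by apply: lerXn2r; rewrite ?nnegrE ?cabs_ge0.
have := cabs_lower (h u) (v ^+ k * g v); lra.
Qed.

End RationalOnDisc.

(** * Critical points accumulate in the Julia set *)

(** Connectedness of the interval: consider the supremum of the parameters up to which [E a] holds.
    It will spread a local property around a circle. *)
Lemma interval_locally_constant (R : realType) (E : R -> R -> Prop) (a b : R) :
  (forall s t, E s t -> E t s) -> (forall s t w, E s t -> E t w -> E s w) ->
  (forall t, a <= t <= b -> exists2 del : R, 0 < del &
     forall s, a <= s <= b -> `|s - t| < del -> E t s) ->
  forall t, a <= t <= b -> E a t.
Proof.
move=> Es Et hloc t1 t1ab; have ab : a <= b by case/andP: t1ab => h1 h2; lra.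
pose A := [set t | a <= t <= t1 /\ forall s, a <= s <= t -> E a s].
have aab : a <= a <= b by rewrite lexx.
have Ea : E a a.
  have [d d0 /(_ a)] := hloc a aab; rewrite subrr normr0; exact.
have Aa : A a.
  case/andP: t1ab => h1 h2; split; first by rewrite lexx.
  by move=> s hs; rewrite (_ : s = a) //; apply/eqP; rewrite eq_le andbC.
have supA : has_sup A by split; [exists a|exists t1 => t [/andP[]]].
set m := sup A.
have am : a <= m by exact: sup_upper_bound.
have mt1 : m <= t1 by apply: sup_le_ub; [exists a|move=> t [/andP[]]].
have mab : a <= m <= b by case/andP: t1ab => h1 h2; rewrite am; lra.
have [d d0 hd] := hloc m mab.
have [t [/andP[at1 tt1] At] tm] := sup_adherent d0 supA.
have tm' : t <= m by apply: sup_upper_bound => //; split=> //; rewrite at1.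
have tab : a <= t <= b by lra.
have Eam : E a m.
  apply: (Et _ t); first by apply: At; rewrite at1 lexx.
  by apply/Es/hd => //; rewrite -/m in tm; rewrite distrC ger0_norm; lra.
have Em s : a <= s <= b -> s < m + d -> E a s.
  move=> sab sd; have [st|st] := lerP s t; first by apply: At; lra.
  apply: Et Eam _; apply: hd => //; rewrite -/m in tm; rewrite ltr_norml; lra.
apply: (Em) => //; rewrite ltNge; apply/negP => h.
suff : m + d / 2 <= m by lra.
apply: sup_upper_bound => //; split; first by lra.
by move=> s hs; apply: Em; lra.
Qed.

Section JuliaCritical.
Variables (R : realType) (f : ratfun R).
Local Notation C := (Cplx R).
Local Notation S := (sphere R).
Implicit Types (u v w a b : C).
Hypothesis hf : nonconstant f.

Variables (x0 : S) (r : R).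
Local Notation u0 := (chart x0 x0).
Local Notation F n u := (iter n f (chart_inv x0 u)).
Hypothesis r0 : 0 < r.

Definition omits a := forall n u, disc u0 r u -> F n u != Some a.

Lemma pt_Some a : Some a = pt a 1 :> S.
Proof. by rewrite /pt oner_eq0 divr1. Qed.

(* On the disc, [1 / (f^n - a)] is thus the quotient of polynomials [q / (p - a q)]. *)
Lemma omits_recip a n : omits a -> exists p q : {poly C},
  [/\ (forall u, (p.[u] != 0) || (q.[u] != 0)), (forall u, F n u = pt p.[u] q.[u]) &
      (forall u, disc u0 r u -> p.[u] - a * q.[u] != 0)].
Proof.
move=> oa; have [p [q [h1 h2]]] := iter_lift f x0 n; exists p, q; split=> // u Du.
apply: contra (oa n u Du) => /eqP h; rewrite h2 pt_Some.
apply/eqP/pt_eqP; rewrite ?h1 ?oner_eq0 ?orbT //.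
by apply/eqP; rewrite mulr1 mulrC -subr_eq0 h.
Qed.

Lemma chordal_pt_Some (p q : C) a : (p != 0) || (q != 0) ->
  chordal (Some a) (pt p q) = 2 * cabs (p - a * q) / (hnrm p q * hnrm a 1).
Proof.
move=> h; rewrite pt_Some chordal_pt ?oner_eq0 ?orbT // mul1r -cabsN opprB.
by rewrite [hnrm a 1 * _]mulrC.
Qed.

Lemma hnrm1_ge1 a : 1 <= hnrm a 1.
Proof. by rewrite hnrm1 sqrt1_ge1. Qed.

(* Where [f^n] is close to [a], the function [f^n - a] has no zero and is bounded
   by 1, by equicontinuity on a neighbourhood not depending on [n]: this is the
   situation of [hurwitz]. *)
Lemma near_omitted_local a u1 : omits a -> cabs (u1 - u0) < r ->
  equicontinuous_at f (chart_inv x0 u1) ->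
  exists2 del : R, 0 < del & forall e : R, 0 < e -> exists2 eta : R, 0 < eta &
    forall n u v, cabs (u - u1) < del -> cabs (v - u1) < del ->
      chordal (Some a) (F n u) < eta -> chordal (Some a) (F n v) < e.
Proof.
move=> oa u1r eq1; set N := hnrm a 1; have N1 : 1 <= N := hnrm1_ge1 a.
have a0 := cabs_ge0 a.
(* As long as the chordal distance to [a] is at most [sg = 1 / A], multiplying it by [A] bounds
   [|f^n - a|]; this yields the bound 1 that [hurwitz] requires. *)
pose A := N * (cabs a + 1); have A1 : 1 <= A by rewrite /A; nra.
have A0 : 0 < A by lra.
pose sg := A^-1; have sg0 : 0 < sg by rewrite invr_gt0.
have sgA : sg * A = 1 by rewrite /sg mulVf // gt_eqF.
have sg3 : 0 < sg / 3 by lra.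
have := @continuous_chart_inv R x0 u1 _ (eq1 _ sg3).
move=> /nbhs_cabsP[d1 d10 hd1].
pose d := Num.min d1 (r - cabs (u1 - u0)).
have d0 : 0 < d by rewrite lt_min d10; lra.
have dd1 : d <= d1 by rewrite ge_min lexx.
have dr : d <= r - cabs (u1 - u0) by rewrite ge_min lexx orbT.
have Dr u : cabs (u - u1) < d -> disc u0 r u.
  move=> ud; rewrite /disc /=; have := cabs_triangle (u - u1) (u1 - u0).
  rewrite addrA subrK; lra.
(* Then [|u - v| < d / 8], a quarter of the radius [d / 2] of the disc around [u] on which [hurwitz]
   is applied. *)
exists (d / 16) => [|e e0]; first by lra.
have e20 : 0 < e / 2 by lra.
have [eta eta0 heta] := hurwitz e20.
exists (Num.min (sg / 3) (eta / A)) => [|n u v hu hv].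
  by rewrite lt_min sg3 divr_gt0.
rewrite lt_min => /andP[h1 h2].
have [p [q [pq hF s0]]] := omits_recip n oa.
have near_u w : disc u (d / 2) w -> cabs (w - u1) < d.
  rewrite /disc /= => wu; have := cabs_triangle (w - u) (u - u1).
  rewrite addrA subrK; lra.
have dist w : disc u (d / 2) w -> chordal (Some a) (F n w) <= sg.
  move=> /near_u wd; have c1 := hd1 w (lt_le_trans wd dd1).
  have ud : cabs (u - u1) < d1 by lra.
  have c2 := hd1 u ud.
  have c1' : chordal (F n u1) (F n w) < sg / 3 := c1 n.
  have c2' : chordal (F n u1) (F n u) < sg / 3 := c2 n.
  have t1 := chordal_triangle (F n u) (Some a) (F n w).
  have t2 := chordal_triangle (F n u1) (F n u) (F n w).
  rewrite [chordal (F n u) (F n u1)]chordalC in t2; lra.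
have bound w : cabs (w - u1) < d -> chordal (Some a) (F n w) <= sg ->
   q.[w] != 0 /\ cabs ((p.[w] - a * q.[w]) / q.[w]) <= chordal (Some a) (F n w) * A.
  move=> wd ds; have sw := s0 w (Dr w wd).
  move: ds; rewrite hF chordal_pt_Some // -/N.
  set s := p.[w] - a * q.[w] in sw *.
  have np := hnrm_gt0 (pq w); set m := hnrm _ _ in np *.
  set D := _ / _ => ds.
  (* Insert this into [2 |s| = D m N]; since [D N <= 1], the resulting term [D N |s|] is absorbed on
     the left. *)
  have mle : m <= cabs s + (cabs a + 1) * cabs q.[w].
    have : m <= cabs p.[w] + cabs q.[w].
      rewrite /m /hnrm -[leRHS]ger0_norm ?addr_ge0 ?cabs_ge0 // -sqrtr_sqr ler_wsqrtr //.
      have := cabs_ge0 p.[w]; have := cabs_ge0 q.[w]; nra.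
    have : cabs p.[w] <= cabs s + cabs a * cabs q.[w].
      by rewrite -cabsM -[p.[w]](subrK (a * q.[w])) cabs_triangle.
    lra.
  have sD : 2 * cabs s = D * (m * N) by rewrite /D; field; rewrite !gt_eqF //; lra.
  have D0 : 0 <= D by rewrite divr_ge0 ?mulr_ge0 ?cabs_ge0 //; lra.
  have DN : D * N <= 1.
    have : D * A <= 1 by rewrite -sgA ler_pM2r.
    rewrite /A; nra.
  have key : cabs s <= D * A * cabs q.[w].
    have h3 : D * (m * N) <= D * N * (cabs s + (cabs a + 1) * cabs q.[w]).
      rewrite [m * N]mulrC mulrA ler_wpM2l // mulr_ge0 //; lra.
    have h4 : D * N * cabs s <= cabs s by rewrite ler_piMl ?cabs_ge0.
    have h5 : D * N * (cabs s + (cabs a + 1) * cabs q.[w]) =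
      D * N * cabs s + D * A * cabs q.[w] by rewrite /A; ring.
    lra.
  have q0 : q.[w] != 0.
    apply: contraTneq key => ->; rewrite cabs0 mulr0 -ltNge cabs_gt0; exact: sw.
  by split=> //; rewrite cabs_div ler_pdivrMr ?cabs_gt0.
have d20 : 0 < d / 2 by lra.
have ud : cabs (u - u1) < d by lra.
have vd : cabs (v - u1) < d by lra.
have pE w : (p - a *: q).[w] = p.[w] - a * q.[w] by rewrite !hornerE.
have hv' : forall w, disc u (d / 2 / 4) w -> cabs ((p - a *: q).[w] / q.[w]) < e / 2.
  apply: heta => //.
- exists (p - a *: q), q => w Dw; split=> //.
  by have [] := bound w (near_u w Dw) (dist w Dw).
- move=> w Dw; have [qw _] := bound w (near_u w Dw) (dist w Dw).
  by rewrite mulf_neq0 ?invr_eq0 // pE; apply: s0; apply/Dr/near_u.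
- move=> w Dw; have dw := dist w Dw; have [qw] := bound w (near_u w Dw) dw.
  rewrite pE => /le_trans; apply.
  by rewrite -[leRHS]sgA ler_pM2r.
- have Du : disc u (d / 2) u by apply: disc_center; exact: ltW.
  have [_] := bound u ud (dist u Du); rewrite pE => /le_lt_trans; apply.
  by rewrite -ltr_pdivlMr.
have uv : cabs (v - u) < d / 8.
  have := cabs_triangle (v - u1) (u1 - u); rewrite addrA subrK (cabs_distC u1); lra.
have Dv : disc u (d / 2) v by rewrite /disc /=; lra.
have [qv _] := bound v vd (dist v Dv).
have {}hv' : cabs ((p.[v] - a * q.[v]) / q.[v]) < e / 2.
  by have := hv' v; rewrite pE; apply; rewrite /disc /=; lra.
rewrite hF chordal_pt_Some // -/N; have np := hnrm_gt0 (pq v).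
rewrite cabs_div ltr_pdivrMr ?cabs_gt0 // in hv'.
rewrite ltr_pdivrMr ?mulr_gt0 //; last by lra.
have qm : cabs q.[v] <= hnrm p.[v] q.[v] * N.
  by apply: le_trans (hnrm_ger p.[v] q.[v]) _; rewrite ler_peMr // ltW.
have : e * cabs q.[v] <= e * (hnrm p.[v] q.[v] * N) by rewrite ler_pM2l.
lra.
Qed.

Hypothesis heq : forall u, u != u0 -> cabs (u - u0) < r ->
  equicontinuous_at f (chart_inv x0 u).

Local Notation rho := (r / 2).
Local Notation circle := [set u | cabs (u - u0) = rho].

Lemma rho_gt0 : 0 < rho. Proof. by rewrite divr_gt0. Qed.

Lemma rho_lt : rho < r.
Proof. by rewrite ltr_pdivrMr // ltr_pMr // ltr1n. Qed.

(** The circle is parametrized by its abscissa, and [s = 1] or [s = -1] selects the half. Both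
    halves start from the same point at [x = -rho]. *)
Definition half_circle (s x : R) : C := u0 + (rc x + 'i%C * rc (s * Num.sqrt (rho ^+ 2 - x ^+ 2))).

Lemma half_circle_in s x : s ^+ 2 = 1 -> - rho <= x <= rho -> circle (half_circle s x).
Proof.
move=> s2 /andP[x1 x2]; rewrite /= /half_circle addrAC subrr add0r cabs_rect.
have h : 0 <= rho ^+ 2 - x ^+ 2 by nra.
by rewrite exprMn s2 mul1r sqr_sqrtr // addrC subrK sqrtr_sqr ger0_norm //; lra.
Qed.

Lemma circle_half u : circle u -> exists s x, [/\ s ^+ 2 = 1, - rho <= x <= rho & u = half_circle s x].
Proof.
move=> /= hu; pose x := complex.Re ((u - u0) : R[i]); pose y := complex.Im ((u - u0) : R[i]).
have uE : u - u0 = rc x + 'i%C * rc y := complexE (u - u0).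
have xy : x ^+ 2 + y ^+ 2 = rho ^+ 2.
  by rewrite -hu uE cabs_rect sqr_sqrtr // addr_ge0 ?sqr_ge0.
exists (if 0 <= y then 1 else -1), x; split.
- by case: ifP => _; rewrite ?sqrrN expr1n.
- have := sqr_ge0 y; move: r0; nra.
rewrite /half_circle -xy addrAC subrr add0r sqrtr_sqr -[LHS](subrK u0) uE addrC.
congr (_ + (_ + _ * rc _)); case: ifP => h; first by rewrite mul1r ger0_norm.
by rewrite mulN1r ler0_norm ?opprK //; lra.
Qed.

Lemma half_circle_continuous s x (e : R) : 0 < e -> exists2 d : R, 0 < d &
  forall y, `|y - x| < d -> cabs (half_circle s y - half_circle s x) < e.
Proof.
move=> e0; pose g y := s * Num.sqrt (rho ^+ 2 - y ^+ 2).
have cg : {for x, continuous g}.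
  apply: cvgM; first exact: cvg_cst.
  apply: continuous_comp; last exact: sqrt_continuous.
  apply: cvgB; first exact: cvg_cst.
  exact: exprn_continuous.
have e20 : 0 < e / 2 by lra.
have /nbhs_ballP[d /= d0 hd] := cg _ (nbhsx_ballx (g x) (e / 2) e20).
exists (Num.min d (e / 2)) => [|y]; first by rewrite lt_min d0.
rewrite lt_min => /andP[y1 y2].
have : ball (g x) (e / 2) (g y) by apply: hd; rewrite /ball /= distrC.
rewrite /ball /= distrC => h.
have -> : half_circle s y - half_circle s x = rc (y - x) + 'i%C * rc (g y - g x).
  by rewrite /half_circle /rc !rmorphB /= -/(rc _); rewrite /g /rc; ring.
rewrite cabs_rect -ltr_sqr ?nnegrE ?sqrtr_ge0 ?(ltW e0) // sqr_sqrtr ?addr_ge0 ?sqr_ge0 //.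
move: y2 h; rewrite !ltr_norml => /andP[h1 h2] /andP[h3 h4].
have : (y - x) ^+ 2 <= (e / 2) ^+ 2 by nra.
have : (g y - g x) ^+ 2 <= (e / 2) ^+ 2 by nra.
nra.
Qed.

(** Local control spreads from [base], the common end of the two halves, and compactness makes it
    uniform. One passes from [u] to [v] through [base], which is why [E] records both directions. *)
Lemma near_omitted_circle a : omits a -> forall e : R, 0 < e -> exists2 eta : R, 0 < eta &
  forall n u v, circle u -> circle v ->
    chordal (Some a) (F n u) < eta -> chordal (Some a) (F n v) < e.
Proof.
move=> oa.
pose E u v := forall e : R, 0 < e -> exists2 eta : R, 0 < eta & forall n,
  (chordal (Some a) (F n u) < eta -> chordal (Some a) (F n v) < e) /\
  (chordal (Some a) (F n v) < eta -> chordal (Some a) (F n u) < e).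
have Es u v : E u v -> E v u.
  by move=> h e /h[eta eta0 he]; exists eta => // n; have [h1 h2] := he n.
have Et u v w : E u v -> E v w -> E u w.
  move=> h1 h2 e e0; have [t1 t10 k1] := h2 e e0; have [t2 t20 k2] := h1 t1 t10.
  have [t3 t30 k3] := h1 e e0; have [t4 t40 k4] := h2 t3 t30.
  exists (Num.min t2 t4) => [|n]; first by rewrite lt_min t20.
  rewrite !lt_min; split=> /andP[p1 p2].
    by apply: (k1 n).1; apply: (k2 n).1.
  by apply: (k3 n).2; apply: (k4 n).2.
have loc u1 : circle u1 -> exists2 del : R, 0 < del & forall e : R, 0 < e ->
   exists2 eta : R, 0 < eta & forall n u v, cabs (u - u1) < del -> cabs (v - u1) < del ->
      chordal (Some a) (F n u) < eta -> chordal (Some a) (F n v) < e.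
  move=> hu; have ur : cabs (u1 - u0) < r by rewrite hu rho_lt.
  apply: near_omitted_local => //; apply: heq => //.
  by rewrite -subr_eq0 -cabs_gt0 hu rho_gt0.
have Eloc u1 : circle u1 -> exists2 del : R, 0 < del & forall u, cabs (u - u1) < del -> E u1 u.
  move=> /loc[del del0 hdel]; exists del => // u hu e e0.
  have [eta eta0 he] := hdel e e0; exists eta => // n.
  by split; apply: he => //; rewrite subrr cabs0.
pose base : C := half_circle 1 (- rho).
have Eb u : circle u -> E base u.
  move=> /circle_half[s [x [s2 xr ->]]].
  have -> : base = half_circle s (- rho).
    by rewrite /base /half_circle sqrrN subrr sqrtr0 !mulr0.
  apply: (@interval_locally_constant R (fun x y => E (half_circle s x) (half_circle s y)) (- rho) rho) => //.
  - by move=> x1 x2; exact: Es.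
  - by move=> x1 x2 x3; exact: Et.
  move=> t tr; have [d d0 hd] := Eloc _ (half_circle_in s2 tr).
  have [d' d'0 hd'] := half_circle_continuous s t d0.
  by exists d' => // x' _ /hd' /hd.
have cc : compact circle.
  apply: (subclosed_compact _ (@compact_disc R u0 rho)); last by move=> u /= ->.
  rewrite (_ : circle = (fun u => cabs (u - u0)) @^-1` [set rho]) //.
  apply: closed_comp; last exact: closed_eq.
  by move=> u _; exact: continuous_dist.
have from_base e : 0 < e -> exists2 eta : R, 0 < eta & forall v, circle v ->
    forall n, chordal (Some a) (F n base) < eta -> chordal (Some a) (F n v) < e.
  move=> e0; apply: (compact_uniform_pos (P := fun eta v => forall n,
    chordal (Some a) (F n base) < eta -> chordal (Some a) (F n v) < e) cc).
    by move=> s t x st h n hn; apply: h; exact: lt_le_trans hn st.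
  move=> v cv; have [del del0 hdel] := loc v cv; have [e1 e10 he1] := hdel e e0.
  have [e2 e20 he2] := Eb v cv e1 e10; exists e2 => //.
  apply: filterS (near_cabs v del0) => w hw n /(he2 n).1; apply: he1 => //.
  by rewrite subrr cabs0.
have to_base e : 0 < e -> exists2 eta : R, 0 < eta & forall v, circle v ->
    forall n, chordal (Some a) (F n v) < eta -> chordal (Some a) (F n base) < e.
  move=> e0; apply: (compact_uniform_pos (P := fun eta v => forall n,
    chordal (Some a) (F n v) < eta -> chordal (Some a) (F n base) < e) cc).
    by move=> s t x st h n hn; apply: h; exact: lt_le_trans hn st.
  move=> v cv; have [del del0 hdel] := loc v cv.
  have [e2 e20 he2] := Eb v cv e e0; have [e1 e10 he1] := hdel e2 e20; exists e1 => //.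
  apply: filterS (near_cabs v del0) => w hw n hn; apply: (he2 n).2; apply: he1 hn => //.
  by rewrite subrr cabs0.
move=> e e0; have [t t0 ht] := from_base e e0; have [eta eta0 heta] := to_base t t0.
by exists eta => // n u v cu cv /(heta u cu)/(ht v cv).
Qed.

(** On the disc [1 / (f^n - a)] is bounded by [2 / k], hence Lipschitz at the centre with a constant
    free of [n]. The factor [2 * hnrm a 1 ^+ 2] pays for returning to the chordal distance through
    the Moebius map [1 / (z - a)]. *)
Lemma omits_far_lipschitz a (k : R) n : 0 < k -> omits a ->
  (forall u, circle u -> k <= chordal (Some a) (F n u)) ->
  forall u, disc u0 rho u ->
    chordal (F n u0) (F n u) <= 2 * hnrm a 1 ^+ 2 * (2 * (2 / k) / rho) * cabs (u - u0).
Proof.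
move=> k0 oa hk u Du; have [p [q [pq hF s0]]] := omits_recip n oa.
have rho0 := rho_gt0.
have sub v : disc u0 rho v -> disc u0 r v.
  by rewrite /disc /= => h; apply: le_trans h (ltW rho_lt).
have N1 := hnrm1_ge1 a; set N := hnrm a 1 in N1 *.
have pE w : (p - a *: q).[w] = p.[w] - a * q.[w] by rewrite !hornerE.
pose G v := q.[v] / (p - a *: q).[v].
have Gr : rational_on (disc u0 rho) G.
  by exists q, (p - a *: q) => v /sub/s0 sv; split=> //; rewrite pE.
have GM : forall v, disc u0 rho v -> cabs (G v) <= 2 / k.
  apply: max_principle => // v cv; have Dv : disc u0 rho v by rewrite /disc /= cv.
  have sv := s0 v (sub v Dv); have := hk v cv; rewrite hF chordal_pt_Some // -/N.
  have np := hnrm_gt0 (pq v).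
  rewrite /G pE cabs_div ler_pdivlMr ?mulr_gt0 //; last by lra.
  move=> h; rewrite ler_pdivrMr ?cabs_gt0 // mulrAC ler_pdivlMr //.
  apply: le_trans h; rewrite mulrC ler_pM2l //.
  apply: le_trans (hnrm_ger p.[v] q.[v]) _; rewrite ler_peMr // ltW //.
have Du0 : disc u0 rho u0 by apply: disc_center; exact: ltW.
have GL := rational_lipschitz rho0 Gr GM Du.
have sE v : disc u0 rho v -> cabs (p.[v] - a * q.[v]) <= N * hnrm p.[v] q.[v].
  move=> _; rewrite (_ : N = hnrm 1 (- a)); last by rewrite /N /hnrm cabsN addrC.
  by rewrite (_ : _ - _ = 1 * p.[v] + (- a) * q.[v]); [exact: hnrm_CS|ring].
have k1 := sE _ Du0; have k2 := sE _ Du.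
rewrite !hF chordal_pt //.
have n1 := hnrm_gt0 (pq u0); have n2 := hnrm_gt0 (pq u).
have s1 := s0 _ (sub _ Du0); have s2 := s0 _ (sub _ Du).
have -> : p.[u0] * q.[u] - q.[u0] * p.[u] =
   (p.[u0] - a * q.[u0]) * (p.[u] - a * q.[u]) * (G u - G u0).
  by rewrite /G !pE; field; rewrite s1 s2.
rewrite !cabsM ler_pdivrMr ?mulr_gt0 //.
move: GL; set L := cabs (G u - G u0); set B := _ * cabs (u - u0) => GL.
have L0 : 0 <= L by exact: cabs_ge0.
apply: (@le_trans _ _ (2 * ((N * hnrm p.[u0] q.[u0]) * (N * hnrm p.[u] q.[u]) * L))).
  by rewrite ler_pM2l // ler_wpM2r // ler_pM ?cabs_ge0.
have -> : 2 * N ^+ 2 * (2 * (2 / k) / rho) * cabs (u - u0) *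
   (hnrm p.[u0] q.[u0] * hnrm p.[u] q.[u]) =
   2 * ((N * hnrm p.[u0] q.[u0]) * (N * hnrm p.[u] q.[u]) * B) by rewrite /B; ring.
rewrite ler_pM2l // ler_wpM2l // !mulr_ge0 ?hnrm_ge0 //; lra.
Qed.

Lemma omits_two_equicontinuous a b : a != b -> omits a -> omits b ->
  equicontinuous_at f x0.
Proof.
move=> ab oa ob; have rho0 := rho_gt0.
have be0 : 0 < chordal (Some a : S) (Some b).
  rewrite lt_neqAle chordal_ge0 andbT eq_sym; apply: contra ab => /eqP/chordal_eq0.
  by case=> ->.
set be := chordal _ _ in be0; have be20 : 0 < be / 2 by lra.
have [eta eta0 heta] := near_omitted_circle oa be20.
(* If [f^n] comes within [k] of [a] on the circle, then it stays within [be / 2] of [a] there, so at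
   least [be / 2 >= k] from [b]. The constant [Ka + Kb] serves in either case. *)
pose k := Num.min eta (be / 2); have k0 : 0 < k by rewrite lt_min eta0.
pose Ka := 2 * hnrm a 1 ^+ 2 * (2 * (2 / k) / rho).
pose Kb := 2 * hnrm b 1 ^+ 2 * (2 * (2 / k) / rho).
have Kp c : 0 <= 2 * hnrm c 1 ^+ 2 * (2 * (2 / k) / rho).
  by rewrite !mulr_ge0 ?invr_ge0 ?exprn_ge0 ?hnrm_ge0 //; lra.
have lip n u : disc u0 rho u -> chordal (F n u0) (F n u) <= (Ka + Kb) * cabs (u - u0).
  move=> Du; have c0 := cabs_ge0 (u - u0); rewrite mulrDl.
  have h1 : 0 <= Ka * cabs (u - u0) by rewrite mulr_ge0 // Kp.
  have h2 : 0 <= Kb * cabs (u - u0) by rewrite mulr_ge0 // Kp.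
  have [[v cv hv]|far] := pselect (exists2 v, circle v & chordal (Some a) (F n v) < k).
    have := @omits_far_lipschitz b k n k0 ob; rewrite -/Kb => /(_ _ u Du) H.
    apply: le_trans (H _) _; last by lra.
    move=> w cw; have k1 : k <= eta by rewrite ge_min lexx.
    have k2 : k <= be / 2 by rewrite ge_min lexx orbT.
    have := heta n v w cv cw (lt_le_trans hv k1).
    have := chordal_triangle (F n w) (Some a) (Some b); rewrite -/be (chordalC (F n w)).
    lra.
  have := @omits_far_lipschitz a k n k0 oa; rewrite -/Ka => /(_ _ u Du) H.
  apply: le_trans (H _) _; last by lra.
  by move=> w cw; rewrite leNgt; apply/negP => h; apply: far; exists w.
move=> eps eps0; apply: near_chart.
have d0 : 0 < eps / (Ka + Kb + 1).
  by rewrite divr_gt0 // ltr_wpDl // addr_ge0 // Kp.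
apply: filterS2 (near_cabs u0 rho0) (near_cabs u0 d0) => u h1 h2 n.
rewrite -{1}(chartK x0); apply: le_lt_trans (lip n u (ltW h1)) _.
have P0 : 0 < Ka + Kb + 1 by rewrite ltr_wpDl // addr_ge0 // Kp.
rewrite ltr_pdivlMr // in h2; have := cabs_ge0 (u - u0); nra.
Qed.

End JuliaCritical.

(** * Critical points are not isolated in the Julia set *)

Section JuliaPerfect.
Variables (R : realType) (f : ratfun R).
Local Notation C := (Cplx R).
Local Notation S := (sphere R).
Implicit Types (x y z : S) (u v w a b : C).
Hypothesis hf : nonconstant f.

Lemma fatou_equicontinuous x : Defs.fatou f x -> equicontinuous_at f x.
Proof. by move=> /fatouP /nbhs_singleton. Qed.

Lemma julia_critical_not_isolated x (U : set S) : julia f x -> critical f x ->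
  nbhs x U -> exists y, [/\ U y, y != x & julia f y].
Proof.
move=> Jx cx Ux; apply: contrapT => isolated.
have nper m : (0 < m)%N -> iter m f x != x.
  by move=> m0; apply/eqP => per; apply: Jx; exact: superattracting_fatou per.
have UF y : U y -> y != x -> Defs.fatou f y.
  by move=> Uy yx; apply: contrapT => Jy; apply: isolated; exists y.
set u0 := chart x x.
have : nbhs u0 (chart_inv x @^-1` U) by apply: continuous_chart_inv; rewrite chartK.
move=> /nbhs_cabsP[r2 r20 hr2].
pose r := r2 / 2; have r0 : 0 < r by rewrite divr_gt0.
have DU u : disc u0 r u -> U (chart_inv x u).
  by rewrite /disc /= => h; apply: hr2; rewrite /r in h; lra.
have inv_neq u : u != u0 -> chart_inv x u != x.
  by apply: contra => /eqP h; rewrite -(chart_invK x u) h.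
have [y1 hy1] := ratmap_surj hf x; have [y2 hy2] := ratmap_surj hf y1.
have [y3 hy3] := ratmap_surj hf y2.
(* If [f^n] took the value [a] at [u], then [f^(j+n)] would send [u] to [x]. For [u = u0] this makes
   [x] periodic; otherwise it moves a Fatou point into the Julia set. *)
have omit (j : nat) a : (0 < j)%N -> iter j f (Some a) = x -> omits f x r a.
  move=> j0 ja n u Du; apply/eqP => h.
  have per : iter (j + n) f (chart_inv x u) = x by rewrite iterD h.
  have [uE|un] := eqVneq u u0.
    by move: per; rewrite uE chartK; apply/eqP/nper; rewrite ltn_addr.
  have : Defs.fatou f (chart_inv x u) by apply: UF; [exact: DU|exact: inv_neq].
  by apply: (julia_iter hf (j + n) _).2; rewrite per.
(* As [x] is not periodic, [y1], [y2], [y3] are pairwise distinct, so at most one of them is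
   infinite. *)
have [a [b [i [j [ab i0 j0 hi hj]]]]] : exists a b (i j : nat),
   [/\ a != b, (0 < i)%N, (0 < j)%N, iter i f (Some a) = x & iter j f (Some b) = x].
  have dis (i j : nat) y : (i < j)%N -> iter i f y = x -> iter j f y = x -> False.
    move=> ij hi; rewrite -(subnK (ltnW ij)) iterD hi; apply/eqP/nper.
    by rewrite subn_gt0.
  have neq (i j : nat) a b : (i < j)%N -> iter i f (Some a) = x -> iter j f (Some b) = x -> a != b.
    by move=> ij hi hj; apply/eqP => e; apply: dis ij hi _; rewrite e.
  have h1 : iter 1 f y1 = x by [].
  have h2 : iter 2 f y2 = x by rewrite iterSr hy2.
  have h3 : iter 3 f y3 = x by rewrite iterSr hy3.
  case: y1 h1 {hy1 hy2 hy3} => [a1|] h1.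
    case: y2 h2 => [a2|] h2; first by exists a1, a2, 1%N, 2%N; split=> //; exact: neq h1 h2.
    case: y3 h3 => [a3|] h3; first by exists a1, a3, 1%N, 3%N; split=> //; exact: neq h1 h3.
    by exfalso; exact: dis h2 h3.
  case: y2 h2 => [a2|] h2; last by exfalso; exact: dis h1 h2.
  case: y3 h3 => [a3|] h3; last by exfalso; exact: dis h1 h3.
  by exists a2, a3, 2%N, 3%N; split=> //; exact: neq h2 h3.
have heq u : u != u0 -> cabs (u - u0) < r -> equicontinuous_at f (chart_inv x u).
  by move=> un ur; apply/fatou_equicontinuous/UF; [apply/DU/ltW|exact: inv_neq].
have ex : equicontinuous_at f x.
  by apply: (omits_two_equicontinuous r0 heq ab); [exact: omit hi|exact: omit hj].
apply: Jx; apply/fatouP.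
apply: filterS Ux => y Uy; have [->//|yx] := eqVneq y x.
exact/fatou_equicontinuous/UF.
Qed.

End JuliaPerfect.

(** * Bimodules of graphs *)

Lemma compact_finite_cover (T : topologicalType) (K : set T) (P : T -> T -> Prop) :
  compact K -> (forall x, K x -> \forall y \near x, P x y) ->
  exists s : seq T, forall y, K y -> exists2 x, x \in s & P x y.
Proof.
move=> /compact_near_coveringP cK hP.
(* Eventually along this filter means for all lists containing some fixed list; near-covering along
   it yields a finite cover. *)
pose fF : set_system (seq T) := [set A : set (seq T) | exists s0 : seq T, forall s : seq T, {subset s0 <= s} -> A s].
have FF : Filter fF.
  split; first by exists [::].
    move=> A B [s1 h1] [s2 h2]; exists (s1 ++ s2) => s hs; split; [apply: h1|apply: h2] => x xs;
      by apply: hs; rewrite mem_cat xs ?orbT.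
  by move=> A B AB [s0 h0]; exists s0 => s /h0 /AB.
have [] := cK (seq T) fF (fun s y => exists2 x, x \in s & P x y) FF.
  move=> x Kx; exists ([set y | P x y], [set s : seq T | x \in s]) => /=.
    by split; [exact: hP|exists [:: x] => s; apply; rewrite inE].
  by move=> [y s] /= [h1 h2]; exists x.
by move=> s hs; exists s => y Ky; apply: (hs s).
Qed.

Lemma cplx_continuousM (R : realType) (T : topologicalType) (f g : T -> Cplx R) :
  continuous f -> continuous g -> continuous (fun x => f x * g x).
Proof. by move=> cf cg x; apply: cvgM; [exact: cf|exact: cg]. Qed.

Section GraphBimodule.
Variables (R : realType) (T : topologicalType) (G : set (T * T)) (e : T -> nat).
Variables (F : T -> T) (d : T -> T -> R) (D N : nat).
Local Notation C := (Cplx R).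
Local Notation fct := (G -> C).
Implicit Types (x y z : T) (p q : G) (h g : fct).

(** The two instances are the sphere and the Julia set with the chordal distance. [N] bounds the
    fibres and [D] the weights. *)
Hypothesis hG : forall p : T * T, G p <-> p.2 = F p.1.
Hypothesis cF : continuous F.
Hypothesis cT : compact [set: T].
Hypothesis dxx : forall x, d x x = 0.
Hypothesis d_ge0 : forall x y, 0 <= d x y.
Hypothesis d_eq0 : forall x y, d x y = 0 -> x = y.
Hypothesis d_cont : forall x, continuous (d x).
Hypothesis d_nbhs : forall x A, nbhs x A ->
  exists2 r : R, 0 < r & forall y, d x y < r -> A y.
Hypothesis fiberF : forall y, exists2 s : seq T, (size s <= N)%N &
  forall x, F x = y -> x \in s.
Hypothesis e_bounds : forall x, (1 <= e x <= D)%N.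

(** With [gfst], a homeomorphism between [T] and the graph; elements of the module become functions
    of one variable. *)
Definition gpt x : G := SigSub (mem_set ((hG (x, F x)).2 erefl)).
Definition gfst p : T := (set_val p).1.

Lemma gfst_gpt x : gfst (gpt x) = x. Proof. by []. Qed.

Lemma gsnd p : (set_val p).2 = F (gfst p).
Proof. by apply/hG; apply: set_valP. Qed.

Lemma gpt_gfst p : gpt (gfst p) = p.
Proof.
apply: val_inj => /=; rewrite -gsnd /gfst -surjective_pairing; by [].
Qed.

Lemma gfst_continuous : continuous gfst.
Proof.
move=> p; apply: (@continuous_comp _ _ _ set_val fst); last exact: cvg_fst.
exact: initial_continuous.
Qed.

Lemma gpt_continuous : continuous gpt.
Proof.
apply: continuous_comp_initial => x.
apply: cvg_pair; first by move=> A.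
exact: cF.
Qed.

Lemma lift_continuous (b : T -> C) : continuous b -> continuous (b \o gfst).
Proof. by move=> cb p; apply: continuous_comp; [exact: gfst_continuous|exact: cb]. Qed.

Lemma restrict_continuous h : continuous h -> continuous (h \o gpt).
Proof. by move=> ch x; apply: continuous_comp; [exact: gpt_continuous|exact: ch]. Qed.

Lemma fiber_seq y : exists s : seq G, [/\ uniq s, (size s <= N)%N &
  forall p, (p \in s) = (F (gfst p) == y)].
Proof.
have [s sN hs] := fiberF y.
exists (undup [seq p <- map gpt s | F (gfst p) == y]); split.
- exact: undup_uniq.
- apply: leq_trans (size_undup _) _; rewrite size_filter.
  by apply: leq_trans (count_size _ _) _; rewrite size_map.
move=> p; rewrite mem_undup mem_filter andb_idr // => /eqP /hs h.
by apply/mapP; exists (gfst p) => //; rewrite gpt_gfst.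
Qed.

(** Listing the fibre turns the sum over a set in [rinner] into an ordinary finite sum. *)
Lemma rinner_seq (s : seq G) y h g : uniq s -> (forall p, (p \in s) = (F (gfst p) == y)) ->
  rinner e h g y = \sum_(p <- s) (e (gfst p))%:R * (h p)^* * g p.
Proof.
move=> us hs; rewrite /rinner (fsbig_seq _ _ us); apply: eq_fsbigl.
by apply/seteqP; split => p /=; rewrite hs gsnd => /eqP.
Qed.

Lemma cabs_rinner_self (s : seq G) y h : uniq s -> (forall p, (p \in s) = (F (gfst p) == y)) ->
  cabs (rinner e h h y) = \sum_(p <- s) (e (gfst p))%:R * cabs (h p) ^+ 2.
Proof.
move=> us hs; rewrite (rinner_seq _ _ us hs).
under eq_bigr do rewrite -mulrA mulr_conj -rc_nat -rcM.
rewrite -(rmorph_sum (real_complex R)) -/(rc _) cabs_rc_ge0 //.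
by apply: sumr_ge0 => p _; rewrite mulr_ge0 ?sqr_ge0.
Qed.

Lemma cabs_rinner_le h g (M M' : R) y : 0 <= M -> 0 <= M' ->
  (forall p, cabs (h p) <= M) -> (forall p, cabs (g p) <= M') ->
  cabs (rinner e h g y) <= N%:R * (D%:R * M * M').
Proof.
move=> M0 M'0 hM gM; have [s [us sN hs]] := fiber_seq y.
rewrite (rinner_seq _ _ us hs); apply: le_trans (cabs_sum _ _ _) _.
apply: (@le_trans _ _ (\sum_(p <- s) D%:R * M * M')).
  apply: ler_sum => p _; rewrite !cabsM cabs_conj cabs_nat.
  apply: ler_pM; rewrite ?mulr_ge0 ?cabs_ge0 //.
  apply: ler_pM; rewrite ?cabs_ge0 // ler_nat.
  by case/andP: (e_bounds (gfst p)).
rewrite big_const_seq count_predT iter_addr_0 -[X in X <= _]mulr_natl.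
by rewrite ler_wpM2r ?mulr_ge0 // ler_nat.
Qed.

(** * Norm estimates in the module *)

Lemma continuous_bounded h : continuous h -> exists2 M : R, 0 <= M & forall p, cabs (h p) <= M.
Proof.
move=> /restrict_continuous ch.
have [|M hM] := @compact_locally_bounded R T setT (fun x => cabs (h (gpt x))) cT.
  move=> x _; exists (cabs (h (gpt x)) + 1).
  have /continuous_cabsP/(_ _ ltr01) := ch x.
  by apply: filterS => y /=; have := cabs_lower (h (gpt y)) (h (gpt x)); lra.
exists `|M| => // p; rewrite -(gpt_gfst p).
by apply: le_trans (hM _ I) _; exact: ler_norm.
Qed.

(** A bound is assumed because [sup] of an unbounded set is a default value. *)
Lemma supnorm_ge (b : T -> C) (M : R) y : (forall y, cabs (b y) <= M) -> cabs (b y) <= supnorm b.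
Proof.
move=> hM; apply: ub_le_sup; last by exists y.
by exists M => _ [z _ <-].
Qed.

Lemma supnorm_le (b : T -> C) (M : R) : 0 <= M -> (forall y, cabs (b y) <= M) -> supnorm b <= M.
Proof.
move=> M0 hM; rewrite /supnorm.
have [[y]|h0] := pselect ([set cabs (b y) | y in setT] !=set0).
  by move=> hy; apply: ge_sup; [exists y|move=> _ [z _ <-]].
by rewrite (_ : [set _ | _ in _] = set0) ?sup0 // -subset0 => z hz; apply: h0; exists z.
Qed.

Lemma hnorm_le h (k : R) : 0 <= k -> (forall y, cabs (rinner e h h y) <= k ^+ 2) -> hnorm e h <= k.
Proof.
move=> k0 hk; rewrite /hnorm -[k](ger0_norm k0) -sqrtr_sqr ler_wsqrtr //.
by apply: supnorm_le => //; exact: sqr_ge0.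
Qed.

Lemma rinner_le_hnorm h (M : R) y : 0 <= M -> (forall p, cabs (h p) <= M) ->
  cabs (rinner e h h y) <= hnorm e h ^+ 2.
Proof.
move=> M0 hM; have h1 : cabs (rinner e h h y) <= supnorm (rinner e h h).
  by apply: supnorm_ge => z; exact: (cabs_rinner_le z M0 M0 hM hM).
by rewrite /hnorm sqr_sqrtr //; apply: le_trans h1; exact: cabs_ge0.
Qed.

(** The square of [|h p|] occurs, with weight at least 1, in a sum of nonnegative terms. *)
Lemma cabs_le_hnorm h (M : R) p : 0 <= M -> (forall p, cabs (h p) <= M) ->
  cabs (h p) <= hnorm e h.
Proof.
move=> M0 hM; rewrite -ler_sqr ?nnegrE ?cabs_ge0 ?sqrtr_ge0 //.
apply: le_trans (rinner_le_hnorm (F (gfst p)) M0 hM).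
have [s [us sN hs]] := fiber_seq (F (gfst p)).
rewrite (cabs_rinner_self _ us hs) (big_rem p) /=; last by rewrite hs.
apply: ler_wpDr; first by apply: sumr_ge0 => q _; rewrite mulr_ge0 ?sqr_ge0.
rewrite -[X in X <= _]mul1r ler_wpM2r ?sqr_ge0 // ler1n.
by case/andP: (e_bounds (gfst p)).
Qed.

Lemma hnorm_mul (w : fct) h (k M : R) : 0 <= k -> (forall p, cabs (w p) <= k) ->
  0 <= M -> (forall p, cabs (h p) <= M) ->
  hnorm e (fun p => w p * h p) <= k * hnorm e h.
Proof.
move=> k0 wk M0 hM; apply: hnorm_le; first by rewrite mulr_ge0 ?sqrtr_ge0.
move=> y; rewrite exprMn; apply: le_trans (_ : k ^+ 2 * cabs (rinner e h h y) <= _); last first.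
  by rewrite ler_wpM2l ?sqr_ge0 // (rinner_le_hnorm y M0 hM).
have [s [us sN hs]] := fiber_seq y.
rewrite !(cabs_rinner_self _ us hs) mulr_sumr; apply: ler_sum => p _.
rewrite cabsM exprMn mulrCA ler_wpM2r ?mulr_ge0 ?cabs_ge0 //.
by apply: lerXn2r; rewrite ?nnegrE ?cabs_ge0.
Qed.

Lemma rinner_single h g p : (forall q, F (gfst q) = F (gfst p) -> q != p -> (h q)^* * g q = 0) ->
  rinner e h g (F (gfst p)) = (e (gfst p))%:R * (h p)^* * g p.
Proof.
move=> h0; have [s [us sN hs]] := fiber_seq (F (gfst p)).
rewrite (rinner_seq _ _ us hs) (bigD1_seq p) ?hs //= big_seq_cond big1 ?addr0 // => q.
by rewrite hs => /andP[/eqP qp qnp]; rewrite -mulrA h0 // mulr0.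
Qed.

(** * Bump functions *)

Definition bump (r : R) x y : R := Num.max 0 (r - d x y).

Lemma bump_ge0 r x y : 0 <= bump r x y.
Proof. by rewrite le_max lexx. Qed.

Lemma bump_gt0 r x y : (0 < bump r x y) = (d x y < r).
Proof. by rewrite lt_max ltxx subr_gt0. Qed.

Lemma bump_eq0 r x y : r <= d x y -> bump r x y = 0.
Proof. by move=> h; apply/max_idPl; lra. Qed.

Lemma bump_le r x y : 0 <= r -> bump r x y <= r.
Proof. by move=> r0; rewrite ge_max r0 /=; have := d_ge0 x y; lra. Qed.

Lemma bump_xx r x : 0 <= r -> bump r x x = r.
Proof. by move=> r0; rewrite /bump dxx subr0; apply/max_idPr. Qed.

Lemma near_real (b : T -> R) x (t : R) : {for x, continuous b} -> 0 < t ->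
  \forall y \near x, `|b y - b x| < t.
Proof.
move=> cb t0; have : \forall y \near x, ball (b x) t (b y) := cb _ (nbhsx_ballx (b x) t t0).
apply: filterS => y.
by rewrite /ball /= distrC.
Qed.

Lemma bump_continuous r x : continuous (bump r x).
Proof.
move=> y A /nbhs_ballP[t /= t0 ht]; apply: filterS (near_real (@d_cont x y) t0) => z hz.
apply: ht; rewrite /ball /= /bump; move: hz; rewrite !ltr_norml !maxEle => /andP[h1 h2].
by case: ifP => h3; case: ifP => h4; apply/andP; split; lra.
Qed.

Lemma separating_bump x : exists zeta : T -> R, [/\ continuous zeta, zeta x = 1,
  (forall y, 0 <= zeta y <= 1) & forall y, F y = F x -> y != x -> zeta y = 0].
Proof.
have [s _ hs] := fiberF (F x).
have [rho rho0 hrho] : exists2 rho : R, 0 < rho & forall y, y \in s -> y != x -> rho <= d x y.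
  elim: s {hs} => [|z s [rho rho0 IH]]; first by exists 1.
  have [zx|zx] := eqVneq z x.
    by exists rho => // y; rewrite inE => /orP[/eqP ->|]; [rewrite zx eqxx|exact: IH].
  have dz : 0 < d x z.
    by rewrite lt_neqAle d_ge0 andbT eq_sym; apply: contra zx => /eqP/d_eq0 ->.
  exists (Num.min rho (d x z)) => [|y]; first by rewrite lt_min rho0.
  rewrite inE => /orP[/eqP ->|ys yx]; first by rewrite ge_min lexx orbT.
  by rewrite ge_min IH.
exists (fun y => bump rho x y / rho); split.
- by move=> y; apply: cvgM; [exact: bump_continuous|exact: cvg_cst].
- by rewrite bump_xx ?divff ?gt_eqF // ltW.
- move=> y; rewrite divr_ge0 ?bump_ge0 ?(ltW rho0) //=.
  by rewrite ler_pdivrMr // mul1r bump_le // ltW.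
- by move=> y /hs ys yx; rewrite bump_eq0 ?mul0r // hrho.
Qed.

Lemma finite_rank_continuous n (c : 'I_n -> C) (xi eta : 'I_n -> fct) :
  (forall i, continuous (xi i) /\ continuous (eta i)) ->
  continuous (fun x => \sum_(i < n) c i * (xi i (gpt x) * (eta i (gpt x))^* )).
Proof.
move=> hc; elim: n c xi eta hc => [|n IH] c xi eta hc x.
  rewrite (_ : (fun x => _) = cst 0); first exact: cst_continuous.
  by apply/funext => y; rewrite big_ord0.
rewrite (_ : (fun x => _) = fun x => c ord0 * (xi ord0 (gpt x) * (eta ord0 (gpt x))^* ) +
   \sum_(i < n) c (lift ord0 i) * (xi (lift ord0 i) (gpt x) * (eta (lift ord0 i) (gpt x))^* )).
  have [c1 c2] := hc ord0.
  apply: cvgD; last by apply: (IH (c \o lift ord0) (xi \o lift ord0) (eta \o lift ord0)) => i; exact: hc.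
  apply: cvgM; first exact: cvg_cst.
  apply: cvgM; first exact: (restrict_continuous c1).
  apply: continuous_comp; last exact: continuous_conj.
  exact: (restrict_continuous c2).
by apply/funext => y; rewrite big_ord_recl.
Qed.

(** The test function is [zeta / m], where [zeta] is 1 at [x] and 0 on the rest of its fibre, so
    each inner product at [F x] reduces to one term with weight [e x]. Dividing by [m] makes the
    norm at most 1, and the summand 1 keeps [m] positive. *)
Lemma compact_approx_pointwise (b : T -> C) n (c : 'I_n -> C) (xi eta : 'I_n -> fct) (eps : R) :
  continuous b -> (forall i, continuous (xi i) /\ continuous (eta i)) -> 0 < eps ->
  (opnorm e (fun g p => (lact b g p -
     \sum_(i < n) c i * rank_one e (xi i) (eta i) g p)%R) < eps%:E)%E ->
  forall x, cabs (b x - (e x)%:R * \sum_(i < n) c i * (xi i (gpt x) * (eta i (gpt x))^* ))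
     <= eps * Num.sqrt (N%:R * D%:R + 1).
Proof.
move=> cb hc eps0 hop x; have [zeta [cz z1 z01 z0]] := separating_bump x.
set M := N%:R * D%:R + 1; have M1 : 1 <= M by rewrite lerDr mulr_ge0.
set m := Num.sqrt M; have m0 : 0 < m by rewrite sqrtr_gt0; lra.
have mm : m ^+ 2 = M by rewrite sqr_sqrtr //; lra.
pose h : fct := fun p => rc (zeta (gfst p) / m).
have ch : continuous h.
  apply: (@lift_continuous (fun y => rc (zeta y / m))) => y.
  apply: continuous_comp; last exact: continuous_rc.
  by apply: cvgM; [exact: cz|exact: cvg_cst].
have hM p : cabs (h p) <= m^-1.
  have /andP[zp0 zp1] := z01 (gfst p).
  by rewrite /h cabs_rc_ge0 ?divr_ge0 ?(ltW m0) // ler_pdivrMr // mulVf // gt_eqF.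
have mi0 : 0 <= m^-1 by rewrite invr_ge0 ltW.
have h1 : hnorm e h <= 1.
  apply: hnorm_le => // y; apply: le_trans (cabs_rinner_le y mi0 mi0 hM hM) _.
  rewrite expr1n -mulrA -invfM -expr2 mm mulrA ler_pdivrMr ?mul1r; last by lra.
  by rewrite /M; lra.
set A := fun g p => _ in hop.
have bdd : exists2 K : R, 0 <= K & forall p, cabs (A h p) <= K.
  have [K1 K10 hK1] := continuous_bounded (lift_continuous cb).
  have [K2 K20 hK2] : exists2 K : R, 0 <= K & forall p,
      cabs (\sum_(i < n) c i * rank_one e (xi i) (eta i) h p) <= K.
    have hx i : exists K : R, forall p, cabs (c i * rank_one e (xi i) (eta i) h p) <= K.
      have [c1 c2] := hc i.
      have [X X0 hX] := continuous_bounded c1; have [Y Y0 hY] := continuous_bounded c2.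
      exists (cabs (c i) * (X * (N%:R * (D%:R * Y * m^-1)))) => p.
      rewrite !cabsM ler_wpM2l ?cabs_ge0 //; apply: ler_pM; rewrite ?cabs_ge0 //.
      exact: cabs_rinner_le.
    have [K hK] := choice hx.
    exists (\sum_(i < n) `|K i|) => [|p]; first exact: sumr_ge0.
    apply: le_trans (cabs_sum _ _ _) _; apply: ler_sum => i _.
    by apply: le_trans (hK i p) _; exact: ler_norm.
  exists (K1 * m^-1 + K2) => [|p]; first by rewrite addr_ge0 ?mulr_ge0.
  apply: le_trans (cabs_triangleB _ _) _; apply: lerD; last exact: hK2.
  rewrite /lact cabsM; apply: ler_pM; rewrite ?cabs_ge0 //.
  exact: hK1.
have [K K0 hK] := bdd.
have hA : hnorm e (A h) < eps.
  rewrite -lte_fin; apply: le_lt_trans hop; apply: ereal_sup_ubound.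
  by exists h.
have := le_lt_trans (cabs_le_hnorm (gpt x) K0 hK) hA.
have hr i : rinner e (eta i) h (F x) = (e x)%:R * (eta i (gpt x))^* * h (gpt x).
  have := @rinner_single (eta i) h (gpt x); rewrite !gfst_gpt; apply=> q qx qn.
  rewrite /h (z0 _ qx) ?mul0r /rc ?rmorph0 ?mulr0 //.
  by apply: contra qn => /eqP qE; rewrite -(gpt_gfst q) qE.
have -> : A h (gpt x) = (b x - (e x)%:R * \sum_(i < n) c i * (xi i (gpt x) * (eta i (gpt x))^* )) * rc m^-1.
  have hx : h (gpt x) = rc m^-1 by rewrite /h gfst_gpt z1 mul1r.
  rewrite /A /lact hx mulrBl; congr (_ - _).
  rewrite mulr_sumr mulr_suml; apply: eq_bigr => i _.
  by rewrite /rank_one /ract /= hr hx; ring.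
by rewrite cabsM cabs_rc_ge0 // ltr_pdivrMr // => /ltW.
Qed.

Lemma compact_ideal_vanishes (b : T -> C) x :
  (forall x, \forall y \near x, y != x -> e y = 1%N) ->
  (forall U, nbhs x U -> exists y, U y /\ y != x) ->
  (2 <= e x)%N -> compact_ideal G e b -> b x = 0.
Proof.
move=> hnear hacc e2 [cb [_ hcomp]].
apply/eqP; rewrite -cabs_eq0 eq_le cabs_ge0 andbT leNgt; apply/negP => be0.
set be := cabs (b x) in be0.
set m := Num.sqrt (N%:R * D%:R + 1) : R.
have m0 : 0 < m by rewrite sqrtr_gt0 ltr_wpDl // mulr_ge0.
(* The comparison will give [(k - 1) * 8 t <= (3 k + 1) * t], which fails for all [k >= 2]. *)
pose t := be / 8; have t0 : 0 < t by rewrite divr_gt0.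
have tm0 : 0 < t / m by rewrite divr_gt0.
have [A0 [n [c [xi [eta [hc ->]]]]] hop] := hcomp _ tm0.
have key := compact_approx_pointwise cb hc tm0 hop.
rewrite -/m divfK ?gt_eqF // in key.
have cs := @finite_rank_continuous n c _ _ hc.
set s := (fun x => \sum_(i < n) _) in cs.
have keys z : cabs (b z - (e z)%:R * s z) <= t := key z.
have /continuous_cabsP/(_ _ t0) nb := cb x.
have /continuous_cabsP/(_ _ t0) ns := cs x.
have [y [[hy1 [hy2 hy3]] yx]] := hacc _ (filterI nb (filterI ns (hnear x))).
have ky := keys y; rewrite (hy3 yx) mul1r in ky.
have bs : cabs (b x - s x) <= 3 * t.
  have -> : b x - s x = (b y - s y) - (b y - b x) + (s y - s x) by ring.
  have := cabs_triangle ((b y - s y) - (b y - b x)) (s y - s x).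
  have := cabs_triangleB (b y - s y) (b y - b x).
  lra.
have kx := keys x; set k := e x in e2 kx.
have k2 : 2 <= k%:R :> R by rewrite ler_nat.
have : (k%:R - 1) * be <= k%:R * (3 * t) + t.
  have -> : (k%:R - 1) * be = cabs (k%:R * (b x - s x) - (b x - k%:R * s x)).
    have -> : k%:R * (b x - s x) - (b x - k%:R * s x) = rc (k%:R - 1) * b x.
      by rewrite /rc rmorphB rmorph1 rmorph_nat; ring.
    by rewrite cabsM cabs_rc_ge0 //; lra.
  apply: le_trans (cabs_triangleB _ _) _; rewrite cabsM cabs_nat.
  by apply: lerD => //; rewrite ler_wpM2l //; lra.
have : 8 * t = be by rewrite /t; lra.
nra.
Qed.

Lemma vanishing_compact_ideal (b : T -> C) :
  (forall x, \forall y \near x, y != x -> e y = 1%N) ->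
  (forall x, e x = 1%N -> exists2 U, nbhs x U & forall y z, U y -> U z -> F y = F z -> y = z) ->
  continuous b -> (forall x, (2 <= e x)%N -> b x = 0) -> compact_ideal G e b.
Proof.
move=> hnear hinj cb b0; split=> //; split.
  split.
    move=> h ch; apply: (@cplx_continuousM R G (b \o gfst) h); last exact: ch.
    exact: (lift_continuous cb).
  exists (lact (fun x => (b x)^* )); split.
    move=> h ch; apply: (@cplx_continuousM R G ((fun x => (b x)^* ) \o gfst) h); last exact: ch.
    apply: (@lift_continuous (fun x => (b x)^* )) => x.
    by apply: continuous_comp; [exact: cb|exact: continuous_conj].
  move=> h g _ _; apply/funext => y; have [s [us sN hs]] := fiber_seq y.
  rewrite !(rinner_seq _ _ us hs); apply: eq_bigr => p _.
  by rewrite /lact rmorphM /=; ring.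
move=> eps eps0; have eps20 : 0 < eps / 2 by lra.
(* [K] is compact and contains no critical point; outside it [|b|] is already below [eps / 2]. *)
pose K := [set x | eps / 2 <= cabs (b x)].
have cK : compact K.
  apply: (subclosed_compact _ cT) => //.
  rewrite (_ : K = (fun x => cabs (b x)) @^-1` [set t | eps / 2 <= t]) //.
  apply: closed_comp; last exact: closed_ge.
  by move=> x _; apply: continuous_comp; [exact: cb|exact: continuous_cabs].
(* On the ball of radius [r x] the weight is 1 and [F] is injective. Points outside [K] get the
   dummy radius 1. *)
have hr x : exists r : R, 0 < r /\ (K x -> (forall y, d x y < r -> e y = 1%N) /\
    forall y z, d x y < r -> d x z < r -> F y = F z -> y = z).
  have [Kx|] := pselect (K x); last by exists 1.
  have ex : e x = 1%N.
    apply/eqP; rewrite eqn_leq; have /andP[-> _] := e_bounds x; rewrite andbT leqNgt.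
    apply/negP => /b0 bx; move: Kx; rewrite /K /= bx cabs0; lra.
  have [U Ux hU] := hinj x ex.
  have [r r0 hr] := d_nbhs (filterI Ux (hnear x)).
  exists r; split=> // _; split.
    by move=> y /hr[_ hy]; have [->//|/hy] := eqVneq y x.
  by move=> y z /hr[Uy _] /hr[Uz _]; exact: hU.
have [r {}hr] := choice hr.
have [s0 hs0] : exists s : seq T, forall y, K y -> exists2 x, x \in s & K x /\ d x y < r x.
  apply: compact_finite_cover cK _ => x Kx.
  have := near_real (@d_cont x x) (hr x).1; apply: filterS => y.
  by rewrite dxx subr0 ger0_norm.
pose s := [seq x <- s0 | `[< K x >]].
have sK x : x \in s -> K x by rewrite mem_filter => /andP[/asboolP].
have sigma_cont (l : seq T) : continuous (fun y => \sum_(x <- l) bump (r x) x y ^+ 2).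
  elim: l => [|z l IH] y.
    rewrite (_ : (fun y => _) = cst 0); first exact: cst_continuous.
    by apply/funext => w; rewrite big_nil.
  rewrite (_ : (fun y => _) = fun y => bump (r z) z y ^+ 2 + \sum_(x <- l) bump (r x) x y ^+ 2).
    apply: cvgD; last exact: IH.
    by apply: cvgM; exact: bump_continuous.
  by apply/funext => w; rewrite big_cons.
pose sigma y := \sum_(x <- s) bump (r x) x y ^+ 2.
have sigma0 y : 0 <= sigma y by apply: sumr_ge0 => x _; exact: sqr_ge0.
have sigmaK y : K y -> 0 < sigma y.
  move=> Ky; have [x xs0 [Kx dxy]] := hs0 y Ky.
  have xs : x \in s by rewrite mem_filter xs0 andbT; apply/asboolP.
  rewrite /sigma (big_rem x) //= ltr_wpDr ?exprn_gt0 ?bump_gt0 //.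
  by apply: sumr_ge0 => z _; exact: sqr_ge0.
have [k k0 hk] : exists2 k : R, 0 < k & forall y, K y -> k <= sigma y.
  apply: (compact_uniform_pos (P := fun k y => k <= sigma y) cK).
    by move=> t1 t2 x; exact: le_trans.
  move=> y Ky; have sy := sigmaK y Ky; exists (sigma y / 2); first by rewrite divr_gt0.
  have sy2 : 0 < sigma y / 2 by rewrite divr_gt0.
  have := near_real (@sigma_cont s y) sy2; apply: filterS => z.
  rewrite -/(sigma _) -/(sigma _) ltr_norml => /andP[h1 h2]; lra.
have [B B0 hB] := continuous_bounded (lift_continuous cb).
(* On [K], where [sigma >= k], this gives [|b| * del / w <= B * del / k <= eps / 2]. *)
pose del := k * (eps / 2) / (B + 1).
have B1 : 0 < B + 1 by lra.
have del0 : 0 < del by rewrite divr_gt0 // mulr_gt0.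
pose w y := sigma y + del.
have w0 y : 0 < w y by rewrite /w; have := sigma0 y; lra.
have w_cont : continuous w.
  by move=> y; apply: cvgD; [exact: sigma_cont|exact: cvg_cst].
pose xs i := tnth (in_tuple s) i.
have xss i : xs i \in s by apply: (mem_tnth i (in_tuple s)).
pose g i y := bump (r (xs i)) (xs i) y.
have g_cont i : continuous (g i) by exact: bump_continuous.
pose xi i : fct := fun p => b (gfst p) * rc (g i (gfst p) / w (gfst p)).
pose eta i : fct := fun p => rc (g i (gfst p)).
exists (fun zeta p => \sum_(i < size s) 1 * rank_one e (xi i) (eta i) zeta p).
  exists (size s), (fun=> 1), xi, eta; split=> // i; split.
    apply: (@lift_continuous (fun x => b x * rc (g i x / w x))) => x.
    apply: cvgM; first exact: cb.
    apply: continuous_comp; last exact: continuous_rc.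
    apply: cvgM; first exact: g_cont.
    by apply: cvgV; [rewrite gt_eqF|exact: w_cont].
  apply: (@lift_continuous (fun x => rc (g i x))) => x.
  by apply: continuous_comp; [exact: g_cont|exact: continuous_rc].
(* Injectivity on the ball kills the other points of the fibre and the weight is 1, so the rank one
   operator is a multiplication. *)
have rank1 i zeta p : rank_one e (xi i) (eta i) zeta p =
   b (gfst p) * rc (g i (gfst p) ^+ 2 / w (gfst p)) * zeta p.
  rewrite /rank_one /ract gsnd.
  have [gi|gi] := ltP (d (xs i) (gfst p)) (r (xs i)); last first.
    by rewrite /xi /g bump_eq0 // expr0n /= !mul0r /rc rmorph0 !(mulr0, mul0r).
  have [he inj] := (hr (xs i)).2 (sK _ (xss i)).
  rewrite rinner_single.
    rewrite he // /xi /eta.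
    have -> : rc (g i (gfst p) ^+ 2 / w (gfst p)) =
       rc (g i (gfst p) / w (gfst p)) * rc (g i (gfst p)) :> C.
      by rewrite -rcM; congr rc; ring.
    have -> : (rc (g i (gfst p)))^* = rc (g i (gfst p)) :> C by exact: conjc_real.
    ring.
  move=> q qp qn; have [gq|gq] := ltP (d (xs i) (gfst q)) (r (xs i)).
    case/eqP: qn; rewrite -(gpt_gfst q) -(gpt_gfst p); congr gpt; exact: inj.
  have -> : eta i q = 0 by rewrite /eta /g bump_eq0 // /rc rmorph0.
  by rewrite rmorph0 mul0r.
have sumE zeta p : \sum_(i < size s) 1 * rank_one e (xi i) (eta i) zeta p =
   b (gfst p) * rc (sigma (gfst p) / w (gfst p)) * zeta p.
  under eq_bigr do rewrite mul1r rank1.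
  rewrite -mulr_suml -mulr_sumr -(rmorph_sum (real_complex R)) -/(rc _) -mulr_suml.
  by rewrite /sigma [in RHS]big_tnth.
(* The operators add up to multiplication by [b * sigma / w]; since [w = sigma + del], the error is
   multiplication by [b * del / w]. *)
rewrite (_ : (fun zeta p => _) = fun zeta p =>
    (b (gfst p) * rc (del / w (gfst p))) * zeta p); last first.
  apply/funext => zeta; apply/funext => p; rewrite sumE /lact -/(gfst p).
  have -> : del / w (gfst p) = 1 - sigma (gfst p) / w (gfst p).
    by rewrite /w; field; rewrite gt_eqF // w0.
  by rewrite /rc rmorphB rmorph1; ring.
have bound p : cabs (b (gfst p) * rc (del / w (gfst p))) <= eps / 2.
  set x := gfst p; rewrite cabsM cabs_rc_ge0; last by rewrite divr_ge0 // ltW.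
  have dw1 : del / w x <= 1 by rewrite ler_pdivrMr // mul1r /w; have := sigma0 x; lra.
  have dw0 : 0 <= del / w x by rewrite divr_ge0 // ltW.
  have [Kx|/negP] := boolP (eps / 2 <= cabs (b x)).
    have bB : cabs (b x) <= B := hB p.
    have : del / w x <= del / k.
      by rewrite ler_pM2l // lef_pV2 ?posrE // /w; have := hk x Kx; lra.
    have -> : del / k = eps / 2 / (B + 1) by rewrite /del; field; rewrite !gt_eqF.
    rewrite ler_pdivlMr // => h; have := cabs_ge0 (b x); nra.
  by move=> /negP; rewrite -ltNge => h; have := cabs_ge0 (b x); nra.
apply: (@le_lt_trans _ _ (eps / 2)%:E); last by rewrite lte_fin; lra.
apply: ge_ereal_sup => _ [h [ch h1] <-]; rewrite lee_fin.
have [M M0 hM] := continuous_bounded ch.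
apply: le_trans (hnorm_mul (ltW eps20) bound M0 hM) _.
by rewrite -[X in _ <= X]mulr1 ler_wpM2l // ltW.
Qed.

End GraphBimodule.

(** * The ideals *)

Section SubspaceTopology.
Variables (T : topologicalType) (J : set T).

Lemma nbhs_set_type (x : J) (U : set J) : nbhs x U ->
  exists2 V : set T, nbhs (set_val x) V & forall y : J, V (set_val y) -> U y.
Proof.
move=> [_ [[V oV <-] Vx] VU]; exists V; last by move=> y Vy; exact: VU.
by apply: open_nbhs_nbhs; split.
Qed.

Lemma set_val_continuous : continuous (set_val : J -> T).
Proof. exact: initial_continuous. Qed.

Lemma compact_set_type : compact J -> compact [set: J].
Proof.
move=> /compact_near_coveringP cJ; apply/compact_near_coveringP => I F P FF hP.
(* Quantifying over the lifts of [x] extends the predicate from the subtype to all of [T]. *)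
have := cJ I F (fun i x => forall y : J, set_val y = x -> P i y) FF.
have h : forall x, J x -> \forall x' \near x & i \near F,
    forall y : J, set_val y = x' -> P i y.
  move=> x Jx; pose x1 : J := SigSub (mem_set Jx).
  have [[U B] /= [Ux1 FB] UB] := hP x1 Logic.I.
  have [V Vx VU] := nbhs_set_type Ux1.
  exists (V, B) => //= -[x' i] /= [Vx' Bi] y yx'.
  by apply: (UB (y, i)); split=> //=; apply: VU; rewrite yx'.
move=> /(_ h); apply: filterS => i hi y _.
by apply: (hi (set_val y)) => //; exact: set_valP.
Qed.

End SubspaceTopology.

Theorem proposition2p5 (R : realType) (f : ratfun R) (hf : nonconstant f) :
  ideal_sphere f =
    [set b : sphere R -> Cplx R | continuous b /\
       forall x, critical f x -> b x = 0]
  /\ (julia f !=set0 ->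
      ideal_julia f =
        [set a : julia f -> Cplx R | continuous a /\
           forall x : julia f, critical f (set_val x) -> a x = 0]).
Proof.
split=> [|_].
  have hG p : graph f p <-> p.2 = f p.1 by [].
  have d_eq0 : forall x y : sphere R, chordal x y = 0 -> x = y by exact: chordal_eq0.
  have d_nbhs (x : sphere R) A : nbhs x A -> exists2 r : R, 0 < r & forall y, chordal x y < r -> A y.
    by move=> /nbhs_chordalP.
  have cT := @sphere_compact R.
  apply/seteqP; split=> b /=.
    move=> hb; split; first by case: hb.
    move=> x cx; apply: (compact_ideal_vanishes hG (@ratmap_continuous R f) cT (@chordal_xx R)
      (@chordal_ge0 R) d_eq0 (@continuous_chordal R) (ratmap_fiber hf) (branch_index_bounds hf)
      (near_noncritical hf) _ cx hb).
    move=> U /nbhs_chordalP[r r0 hr]; have [y yx /hr Uy] := sphere_perfect x r0.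
    by exists y.
  move=> [cb b0]; apply: (vanishing_compact_ideal hG (@ratmap_continuous R f) cT (@chordal_xx R)
      (@chordal_ge0 R) (@continuous_chordal R) d_nbhs (ratmap_fiber hf) (branch_index_bounds hf)
      (near_noncritical hf) (ratmap_local_inj hf) cb b0).
(* Forward invariance lets [f] restrict to the Julia set. *)
pose F (x : julia f) : julia f := SigSub (mem_set ((julia_image hf _).1 (set_valP x))).
pose d (x y : julia f) := chordal (set_val x) (set_val y).
have hG p : julia_graph f p <-> p.2 = F p.1.
  by split=> h; [exact: val_inj|rewrite /julia_graph /= h].
have cF : continuous F.
  apply: continuous_comp_initial => x.
  apply: (@continuous_comp _ _ _ set_val f); first exact: set_val_continuous.
  exact: ratmap_continuous.
have cT : compact [set: julia f].
  apply: compact_set_type; apply: (subclosed_compact _ (@sphere_compact R)) => //.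
  by apply: open_closedC; exact: fatou_open.
have dxx x : d x x = 0 by exact: chordal_xx.
have d_ge0 x y : 0 <= d x y by exact: chordal_ge0.
have d_eq0 x y : d x y = 0 -> x = y by move=> /chordal_eq0; exact: val_inj.
have d_cont x : continuous (d x).
  move=> y; apply: (@continuous_comp _ _ _ set_val (chordal (set_val x))).
    exact: set_val_continuous.
  exact: continuous_chordal.
have d_nbhs x A : nbhs x A -> exists2 r : R, 0 < r & forall y, d x y < r -> A y.
  move=> /nbhs_set_type[V /nbhs_chordalP[r r0 hr] VA].
  by exists r => // y /hr/VA.
have fiber (y : julia f) : exists2 s : seq (julia f), (size s <= (ratdeg f).+1)%N &
    forall x, F x = y -> x \in s.
  have [s sN hs] := ratmap_fiber hf (set_val y).
  (* [insub] keeps the listed points that lie in the Julia set. *)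
  exists (pmap insub s); first by rewrite size_pmap (leq_trans (count_size _ _)) // .
  move=> x xy; rewrite mem_pmap_sub; apply: hs.
  by rewrite -xy.
have e_bounds (x : julia f) : (1 <= (branch_index f \o set_val) x <= ratdeg f)%N by exact: branch_index_bounds.
have hnear (x : julia f) : \forall y \near x, y != x -> (branch_index f \o set_val) y = 1%N.
  have : \forall y \near x, set_val y != set_val x -> branch_index f (set_val y) = 1%N.
    exact: set_val_continuous (near_noncritical hf (set_val x)).
  by apply: filterS => y h yx; apply: h; apply: contra yx => /eqP/val_inj ->.
apply/seteqP; split=> b /=.
  move=> hb; split; first by case: hb.
  move=> x cx; apply: (compact_ideal_vanishes hG cF cT dxx d_ge0 d_eq0 d_cont fiber e_bounds
    hnear _ cx hb).
  move=> U /nbhs_set_type[V Vx VU].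
  have [y [Vy yx Jy]] := julia_critical_not_isolated hf (set_valP x) cx Vx.
  exists (SigSub (mem_set Jy)); split; first exact: VU.
  by apply: contra yx => /eqP h; rewrite -h.
move=> [cb b0]; apply: (vanishing_compact_ideal hG cF cT dxx d_ge0 d_cont d_nbhs fiber e_bounds
   hnear _ cb b0) => x ex.
have [U Ux hU] := ratmap_local_inj hf ex.
exists (set_val @^-1` U); first exact: set_val_continuous.
move=> y z Uy Uz /(congr1 set_val) /= h; apply: val_inj; exact: hU.
Qed.
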